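(* There exist a free group $F$ of finite rank and a recursive normal subgroup $N\unlhd F$ such that the conjugacy problem $\mathrm{CP}(F/N)$ is undecidable and the conjugacy problem $\mathrm{CP}(F/N')$ is decidable.
   Context: $N'=[N,N]$ is the derived subgroup of $N$. If $X$ is a free basis of $F$, the groups $F/N$ and $F/N'$ are considered with the generating set $X$. $\mathrm{CP}(G)$: given words $u,v$ in the generators of $G$ and their inverses, decide whether $u$ and $v$ are conjugate in $G$. The subgroup $N$ is recursive if the set of words over $X\cup X^{-1}$ representing elements of $N$ is a recursive set. *)

(* Defs.v *)
From HB Require Import structures.
From mathcomp Require Import all_boot.
From mathcomp Require Import boolp.

Set Implicit Arguments.
Unset Strict Implicit.
Unset Printing Implicit Defensive.

Local Open Scope group_scope.
Local Open Scope quotient_scope.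

(* Kleene's partial recursive functions of arity [k]. *)
Inductive recfun : nat -> Type :=
| RZero k : recfun k
| RSucc : recfun 1
| RProj k : 'I_k -> recfun k
| RComp k m : recfun m -> ('I_m -> recfun k) -> recfun k
| RPrec k : recfun k -> recfun k.+2 -> recfun k.+1
| RMin k : recfun k.+1 -> recfun k.

(* [computes f x y]: the partial function [f] is defined at [x], with value [y].
   In the case of [RPrec], [s i] is the value at [i :: x']. *)
Fixpoint computes k (f : recfun k) : k.-tuple nat -> nat -> Prop :=
  match f in recfun k return k.-tuple nat -> nat -> Prop with
  | RZero _ => fun _ y => y = 0
  | RSucc => fun x y => y = (thead x).+1
  | RProj _ i => fun x y => y = tnth x i
  | RComp _ m g h => fun x y => exists2 z : m.-tuple nat,
      (forall i, computes (h i) x (tnth z i)) & computes g z y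
  | RPrec _ g h => fun x y => exists s : nat -> nat,
      [/\ computes g [tuple of behead x] (s 0),
          forall i, i < thead x ->
            computes h [tuple of i :: s i :: behead x] (s i.+1)
        & y = s (thead x)]
  | RMin _ g => fun x y =>
      computes g [tuple of y :: x] 0 /\
      (forall i, i < y -> exists z, computes g [tuple of i :: x] z.+1)
  end.

Lemma computes_functional k (f : recfun k) x y y' :
  computes f x y -> computes f x y' -> y = y'.
Proof.
elim: f x y y' => {k} [k|||k m g IHg h IHh|k g IHg h IHh|k g IHg] /=.
- by move=> x y y' -> ->.
- by move=> x y y' -> ->.
- by move=> k i x y y' -> ->.
- move=> x y y' [z zh zg] [z' zh' zg'].
  suff zz' : z = z' by move: zg; rewrite zz' => zg; exact: IHg zg zg'.
  by apply: eq_from_tnth => i; apply: IHh (zh i) (zh' i).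
- move=> x y y' [s [s0 sS ->]] [s' [s'0 s'S ->]].
  suff /(_ _ (leqnn _)) : forall i, i <= thead x -> s i = s' i by [].
  elim=> [_|i IHi ix]; first exact: IHg s0 s'0.
  by have := sS i ix; rewrite IHi ?(ltnW ix)// => si; apply: IHh si (s'S i ix).
- move=> x y y' [y0 yS] [y'0 y'S]; case: (ltngtP y y') => // lt.
  + by have [z zy] := y'S _ lt; have := IHg _ _ _ y0 zy.
  + by have [z zy] := yS _ lt; have := IHg _ _ _ y'0 zy.
Qed.

(* The letter [(i, false)] stands for the [i]-th generator, [(i, true)] for its
   inverse. *)
Definition word n := seq ('I_n * bool).

Definition word_value (G : groupType) n (X : 'I_n -> G) (w : word n) : G :=
  \prod_(a <- w) (if a.2 then (X a.1)^-1 else X a.1).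

(* Bijective numeration in base [2 * n]: the letter [(i, b)] is the digit
   [2 * i + b + 1]. *)
Definition word_code n (w : word n) : nat :=
  foldr (fun (a : 'I_n * bool) m => (2 * n * m + (2 * a.1 + a.2 + 1))%N) 0 w.

Definition recursive_words n (P : word n -> Prop) : Prop :=
  exists f : recfun 1, forall w, computes f [tuple word_code w] `[< P w >].

Definition recursive_words2 n (P : word n -> word n -> Prop) : Prop :=
  exists f : recfun 2, forall u v,
    computes f [tuple word_code u; word_code v] `[< P u v >].

Definition conjugate (G : groupType) (x y : G) : Prop := exists g : G, y = x ^ g.

Definition conjugacy_problem_decidable (G : groupType) n (X : 'I_n -> G) : Prop :=
  recursive_words2 (fun u v => conjugate (word_value X u) (word_value X v)).

Definition free_basis (F : groupType) n (X : 'I_n -> F) : Prop :=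
  forall (G : groupType) (f : 'I_n -> G),
  exists2 phi : {multiplicative F -> G},
    forall i, phi (X i) = f i
  & forall psi : {multiplicative F -> G}, (forall i, psi (X i) = f i) -> psi =1 phi.

HB.mixin Record isConjClosed (G : groupType) (S : {pred G}) := {
  gpredJ_all : forall x y : G, x \in S -> x ^ y \in S
}.

#[short(type="normalSubgroup")]
HB.structure Definition NormalSubgroup (G : groupType) :=
  {S of isConjClosed G S & GroupClosed G S}.

Section Quotient.
Variables (G : groupType) (N : normalSubgroup G).

Definition coset_rel : rel G := fun x y => x^-1 * y \in N.

Fact coset_rel_refl : reflexive coset_rel.
Proof. by move=> x; rewrite /coset_rel mulVg gpred1. Qed.

Fact coset_rel_sym : symmetric coset_rel.
Proof. by move=> x y; rewrite /coset_rel -gpredV invgM invgK. Qed.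

Fact coset_rel_trans : transitive coset_rel.
Proof.
move=> y x z xy yz; rewrite /coset_rel.
by have := gpredM _ _ xy yz; rewrite mulgA mulgK.
Qed.

Canonical coset_equiv :=
  EquivRel coset_rel coset_rel_refl coset_rel_sym coset_rel_trans.

Definition quotient_group := {eq_quot coset_equiv}.

HB.instance Definition _ := Choice.on quotient_group.
HB.instance Definition _ := EqQuotient.on quotient_group.

Definition quotient_one : quotient_group := \pi 1.
Definition quotient_mul : quotient_group -> quotient_group -> quotient_group :=
  lift_op2 quotient_group (fun x y : G => x * y).
Definition quotient_inv : quotient_group -> quotient_group :=
  lift_op1 quotient_group (fun x : G => x^-1).

Lemma quotient_eqE (x y : G) :
  (x == y %[mod quotient_group]) = (x^-1 * y \in N).
Proof. by rewrite piE. Qed.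

Lemma pi_quotient_mul (x y : G) :
  \pi_quotient_group (x * y) =
    quotient_mul (\pi_quotient_group x) (\pi_quotient_group y).
Proof.
rewrite /quotient_mul; unlock; apply/eqP; rewrite quotient_eqE.
case: piP => x' /eqP; rewrite quotient_eqE => xN.
case: piP => y' /eqP; rewrite quotient_eqE => yN.
have -> : (x * y)^-1 * (x' * y') = (x^-1 * x') ^ y * (y^-1 * y').
  by rewrite /conjg invgM !mulgA mulgK.
by rewrite gpredM // gpredJ_all.
Qed.

Lemma pi_quotient_inv (x : G) :
  \pi_quotient_group x^-1 = quotient_inv (\pi_quotient_group x).
Proof.
rewrite /quotient_inv; unlock; apply/eqP; rewrite quotient_eqE invgK.
case: piP => y /eqP; rewrite quotient_eqE => xyN.
have -> : x * y^-1 = ((x^-1 * y)^-1) ^ x^-1.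
  by rewrite /conjg invgM !invgK !mulgA mulgK.
by rewrite gpredJ_all // gpredV.
Qed.

Fact quotient_mulgA : associative quotient_mul.
Proof.
elim/quotW=> x; elim/quotW=> y; elim/quotW=> z.
by rewrite -!pi_quotient_mul mulgA.
Qed.

Fact quotient_mul1g : left_id quotient_one quotient_mul.
Proof. by elim/quotW=> x; rewrite -pi_quotient_mul mul1g. Qed.

Fact quotient_mulg1 : right_id quotient_one quotient_mul.
Proof. by elim/quotW=> x; rewrite -pi_quotient_mul mulg1. Qed.

Fact quotient_mulVg : left_inverse quotient_one quotient_inv quotient_mul.
Proof. by elim/quotW=> x; rewrite -pi_quotient_inv -pi_quotient_mul mulVg. Qed.

Fact quotient_mulgV : right_inverse quotient_one quotient_inv quotient_mul.
Proof. by elim/quotW=> x; rewrite -pi_quotient_inv -pi_quotient_mul mulgV. Qed.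

HB.instance Definition _ := isGroup.Build quotient_group
  quotient_mulgA quotient_mul1g quotient_mulg1 quotient_mulVg quotient_mulgV.

Definition quotient_map (x : G) : quotient_group := \pi x.

End Quotient.

Section Derived.
Variables (G : groupType) (N : normalSubgroup G).

(* The subgroup generated by the commutators of elements of [N]. *)
Definition derived : {pred G} := fun x =>
  `[< forall H : groupClosed G,
        {in N &, forall a b, [~ a, b] \in H} -> x \in H >].

Fact derived_mulg_closed : mulg_closed derived.
Proof.
move=> x y /asboolP xN /asboolP yN; apply/asboolP=> H HN.
by rewrite gpredM ?xN ?yN.
Qed.

Fact derived_1 : 1 \in derived.
Proof. by apply/asboolP=> H _; exact: gpred1. Qed.

Fact derived_invg_closed : invg_closed derived.
Proof. by move=> x /asboolP xN; apply/asboolP=> H HN; rewrite gpredV xN. Qed.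

HB.instance Definition _ := isMulClosed.Build G derived derived_mulg_closed.
HB.instance Definition _ := isMul1Closed.Build G derived derived_1.
HB.instance Definition _ := isInvClosed.Build G derived derived_invg_closed.

Fact derived_conj (x y : G) : x \in derived -> x ^ y \in derived.
Proof.
move=> /asboolP xN; apply/asboolP=> H HN.
pose K : {pred G} := fun z => z ^ y \in H.
have KE z : (z \in K) = (z ^ y \in H) by [].
have KM : mulg_closed K by move=> u v; rewrite !KE conjMg; exact: gpredM.
have K1 : 1 \in K by rewrite KE conj1g gpred1.
have KV : invg_closed K by move=> u; rewrite !KE conjVg gpredV.
pose cM := isMulClosed.Build G K KM.
pose c1 := isMul1Closed.Build G K K1.
pose cV := isInvClosed.Build G K KV.
pose K' : groupClosed G := HB.pack K cM c1 cV.
apply: (xN K') => a b aN bN.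
by rewrite KE conjRg HN // gpredJ_all.
Qed.

HB.instance Definition _ := isConjClosed.Build G derived derived_conj.

End Derived.

(* Main.v *)
(* Let [S] be the subgroup [N<v>] of [F]. As [N/N'] is an abelian normal subgroup of
   [F/N'], modulo [N'] the subgroup [[S, S]] consists of the elements
   [a v a^-1 v^-1] with [a] in [N]; hence [u] and [v] are conjugate in [F/N'] iff
   [h u h^-1 v^-1] is in [[S, S]] for some [h]. A word with value in [S] has its value
   in [[S, S]] iff the path that it labels in the Schreier graph of [S] has zero flow
   through each edge. Comparing the flows of [u] and [v], one may take
   [h = p r^-1] for a prefix [p] of [v] and a prefix [r] of [u]. So the conjugacy
   problem in [F/N'] reduces to membership in [N] and in the subgroups [N<v>].

   The group [F/N] acts on a head position [s] and two binary tapes [p] and [q]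
   indexed by the integers: one generator moves the head, one flips [q s], and one
   adds [q (d + s)] to [p d] for all [d] outside a recursive set [Z] of positive
   integers. The fourth power of an element that does not move the head is trivial,
   so membership in [N<v>] is a bounded search. For [Z] the set of the
   [2^e (2 c + 1)] with [T e c], where the relation [T] is recursive but its
   projection [exists c, T e c] is not, two words that depend computably on [e] are
   conjugate in [F/N] iff [Z] contains some [2^e + 2^(e+1) c]. *)

From HB Require Import structures.
Require Import Defs.
From mathcomp Require Import all_boot all_algebra.
From mathcomp Require Import boolp zify.

Set Implicit Arguments.
Unset Strict Implicit.
Unset Printing Implicit Defensive.

(** * Recursive functions on encoded data *)

(** The obstacle is to make conjugacy in [F/N] undecidable while membership in every [N<v>] stays
    decidable. A central extension of a group of lamplighter type does this. The commutator of a
    writing at [x] and a toggling at [y] flips the cell [y - x] of the first tape (unless erased)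
    and nothing else. This flip commutes with all generators: moving and toggling do not touch the
    first tape, and writing only adds to it. Erasing a cell makes its central flip trivial, which
    costs the word problem a single test. Conjugacy of the two words, however, asks for a finite set
    [Y] of togglings such that [Y(d) + Y(d + m)], modulo 2, singles out one given cell [j] among the
    cells that are not erased. Along the progression [j + i m] this is possible only if some erased
    cell cuts it off, and finding that cell is an unbounded search. In [F/N'] the search is finite
    because conjugation by [h] merely translates the flow of [u]: as soon as some edge carries flow,
    the translated path of [u] and the path of [v] share a vertex, and this fixes [h] up to a factor
    in [S]. *)

Class encoding (A : Type) := encode : A -> nat.
(* A context is a nested product [A1 * (... * (Ak * unit))] of the values of the
   variables, read as a [k]-tuple of codes. *)
Class context (C : Type) := Context { arity : nat; vals : C -> arity.-tuple nat }.
Arguments arity C {_}.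

Instance encode_nat : encoding nat := id.
Instance encode_bool : encoding bool := nat_of_bool.
Instance encode_ord n : encoding 'I_n := @nat_of_ord n.
Instance encode_seq A {eA : encoding A} : encoding (seq A) :=
  fun s => CodeSeq.code (map encode s).
Instance encode_pair A B {eA : encoding A} {eB : encoding B} :
  encoding (A * B) := fun p => CodeSeq.code [:: encode p.1; encode p.2].

Instance context_nil : context unit := Context (fun _ => [tuple]).
Instance context_cons A C {eA : encoding A} {cC : context C} :
  context (A * C) := Context (fun g => [tuple of encode g.1 :: vals g.2]).

Definition computable {C} {cC : context C} {A} {eA : encoding A} (F : C -> A) :=
  exists f : recfun (arity C), forall g, computes f (vals g) (encode (F g)).

Definition substitution {C D} {cC : context C} {cD : context D} (S : C -> D) :=
  exists f : 'I_(arity D) -> recfun (arity C),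
    forall g i, computes (f i) (vals g) (tnth (vals (S g)) i).

Section Basic.
Context {C : Type} {cC : context C}.

Lemma comp_ext A {eA : encoding A} (F G : C -> A) :
  F =1 G -> computable F -> computable G.
Proof. by move=> FG [f Pf]; exists f => g; rewrite -FG. Qed.

(** Computability concerns codes only, so it passes between types whose values have equal codes.
    Lists, pairs, integers and words can thus be programmed as arithmetic on codes. *)
Lemma comp_encode A B {eA : encoding A} {eB : encoding B} (F : C -> A)
    (G : C -> B) :
  (forall g, encode (F g) = encode (G g)) -> computable F -> computable G.
Proof. by move=> FG [f Pf]; exists f => g; rewrite -FG. Qed.

Lemma subst_id : substitution (fun g : C => g).
Proof. by exists (fun i => RProj i). Qed.

Lemma subst_snd D {cD : context D} A {eA : encoding A} (S : C -> A * D) :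
  substitution S -> substitution (fun g => (S g).2).
Proof.
case=> f Pf; exists (fun i => f (lift ord0 i)) => g i.
by have := Pf g (lift ord0 i); rewrite tnthS.
Qed.

Lemma comp_var D {cD : context D} A {eA : encoding A} (S : C -> A * D) :
  substitution S -> computable (fun g => (S g).1).
Proof. by case=> f Pf; exists (f ord0) => g; have := Pf g ord0; rewrite tnth0. Qed.

Lemma subst_nil : substitution (fun _ : C => tt).
Proof. by exists (fun _ => RZero _) => g []. Qed.

Lemma subst_cons D {cD : context D} A {eA : encoding A} (F : C -> A)
    (S : C -> D) :
  computable F -> substitution S -> substitution (fun g => (F g, S g)).
Proof.
move=> [f Pf] [h Ph].
exists (fun i => if unlift ord0 i is Some j then h j else f) => g i.
by case: unliftP => [j|] ->; rewrite ?tnthS ?tnth0.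
Qed.

Lemma comp_subst D {cD : context D} A {eA : encoding A} (F : D -> A)
    (S : C -> D) :
  computable F -> substitution S -> computable (fun g => F (S g)).
Proof.
move=> [f Pf] [h Ph]; exists (RComp f h) => g /=.
by exists (vals (S g)).
Qed.

Lemma comp_app1 A B {eA : encoding A} {eB : encoding B} (F : A -> B) G :
  computable (fun p : A * unit => F p.1) -> computable G ->
  computable (fun g : C => F (G g)).
Proof.
move=> PF PG; apply: (comp_subst (S := fun g => (G g, tt)) PF).
exact: subst_cons PG subst_nil.
Qed.

Lemma comp_app2 A A' B {eA : encoding A} {eA' : encoding A'} {eB : encoding B}
    (F : A -> A' -> B) G H :
  computable (fun p : A * (A' * unit) => F p.1 p.2.1) ->
  computable G -> computable H -> computable (fun g : C => F (G g) (H g)).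
Proof.
move=> PF PG PH; apply: (comp_subst (S := fun g => (G g, (H g, tt))) PF).
exact: subst_cons PG (subst_cons PH subst_nil).
Qed.

Lemma comp_succ F : computable F -> computable (fun g : C => (F g).+1).
Proof.
case=> f Pf; exists (RComp RSucc (fun _ => f)) => g /=.
by exists [tuple encode (F g)] => [i|] //; rewrite (ord1 i) tnth0.
Qed.

Lemma comp_nat (n : nat) : computable (fun _ : C => n).
Proof.
by elim: n => [|n IHn]; [exists (RZero _) | exact: comp_succ].
Qed.

Lemma comp_cst A {eA : encoding A} a : computable (fun _ : C => a).
Proof. exact: comp_encode (comp_nat (encode a)). Qed.

Lemma comp_rec A {eA : encoding A} (G : C -> A) (H : nat -> A -> C -> A) N :
  computable G -> computable (fun p : nat * (A * C) => H p.1 p.2.1 p.2.2) ->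
  computable N ->
  computable (fun g => nat_rect (fun _ => A) (G g) (fun i s => H i s g) (N g)).
Proof.
move=> [f Pf] [h Ph] [n Pn].
exists (RComp (RPrec f h)
  (fun i => if unlift ord0 i is Some j then RProj j else n)) => g /=.
exists [tuple of encode (N g) :: vals g] => [i|].
  by case: unliftP => [j|] ->; rewrite ?tnthS ?tnth0.
exists (fun i => encode (nat_rect (fun _ => A) (G g) (fun i s => H i s g) i)).
have -> : [tuple of behead [tuple of encode (N g) :: vals g]] = vals g.
  exact: val_inj.
split=> // i _.
have := Ph (i, (nat_rect (fun _ => A) (G g) (fun i s => H i s g) i, g)).
set t := vals _; set t' := [tuple of _]; have -> // : t = t'.
exact: val_inj.
Qed.

End Basic.

(* A goal [computable (fun g => E)] is decomposed along the head symbol of [E];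
   [comp_step] is extended as more operations become available. *)
Ltac subst_solve :=
  lazymatch goal with
  | |- substitution (fun x => x) => exact subst_id
  | |- substitution (fun x => snd (@?S x)) => apply (@subst_snd _ _ _ _ _ _ S); subst_solve
  | |- substitution (fun _ => tt) => exact subst_nil
  | |- substitution (fun x => (@?F x, @?S x)) => apply (@subst_cons _ _ _ _ _ _ F S)
  end.
Ltac comp_step := fail.
Ltac comp_core :=
  lazymatch goal with
  | |- computable (fun x => fst (@?S x)) => apply (@comp_var _ _ _ _ _ _ S); subst_solve
  | |- computable (fun _ => ?a) => apply comp_cst
  | |- computable (fun g => S (@?F g)) => apply (@comp_succ _ _ F)
  | |- computable (fun g => nat_rect (fun _ => ?A) (@?G g) (fun i s => @?H g i s) (@?N g)) =>
      apply (@comp_rec _ _ A _ G (fun i s g => H g i s) N)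
  end.
Ltac eta_expand :=
  lazymatch goal with
  | |- computable (fun _ => _) => fail
  | |- @computable ?C ?cC ?A ?eA ?F => change (@computable C cC A eA (fun x => F x))
  end.
Ltac comp_hyp :=
  match goal with
  | H : computable ?F |- computable (fun x => ?F (@?S x)) =>
      apply (@comp_subst _ _ _ _ _ _ F S H)
  end.
Ltac comp := repeat (cbv beta; first
  [ assumption | eta_expand | subst_solve | comp_core | comp_hyp | comp_step ]).

(** * Arithmetic, tests and iteration *)

Lemma comp_add C {cC : context C} F G : computable F -> computable G ->
  computable (fun g : C => F g + G g).
Proof.
apply: comp_app2.
apply: (comp_ext (F := fun p => nat_rect (fun _ => nat) p.1 (fun _ s => s.+1) p.2.1)).
  by move=> [m [n ?]] /=; elim: n => [|n IHn] /=; rewrite ?addn0 ?IHn ?addnS.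
comp.
Qed.

Lemma comp_pred C {cC : context C} F : computable F ->
  computable (fun g : C => (F g).-1).
Proof.
apply: (comp_app1 (F := predn)).
apply: (comp_ext (F := fun p => nat_rect (fun _ => nat) 0 (fun i _ => i) p.1)).
  by case=> -[].
comp.
Qed.

Ltac comp_step ::= lazymatch goal with
  | |- computable (fun g => predn (@?F g)) => apply (@comp_pred _ _ F)
  | |- computable (fun g => (@?F g) + (@?G g)) => apply (@comp_add _ _ F G)
  end.

Lemma comp_sub C {cC : context C} F G : computable F -> computable G ->
  computable (fun g : C => F g - G g).
Proof.
apply: comp_app2.
apply: (comp_ext
  (F := fun p => nat_rect (fun _ => nat) p.1 (fun _ s => s.-1) p.2.1)).
  by move=> [m [n ?]] /=; elim: n => [|n IHn] /=; rewrite ?subn0 // IHn subnS.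
comp.
Qed.

Lemma comp_mul C {cC : context C} F G : computable F -> computable G ->
  computable (fun g : C => F g * G g).
Proof.
apply: comp_app2.
apply: (comp_ext
  (F := fun p => nat_rect (fun _ => nat) 0 (fun _ s => p.2.1 + s) p.1)).
  by move=> [m [n ?]] /=; elim: m => //= m ->.
comp.
Qed.

Ltac step_arith := lazymatch goal with
  | |- computable (fun g => predn (@?F g)) => apply (@comp_pred _ _ F)
  | |- computable (fun g => (@?F g) + (@?G g)) => apply (@comp_add _ _ F G)
  | |- computable (fun g => (@?F g) - (@?G g)) => apply (@comp_sub _ _ F G)
  | |- computable (fun g => (@?F g) * (@?G g)) => apply (@comp_mul _ _ F G)
  end.
Ltac comp_step ::= step_arith.

Lemma comp_exp C {cC : context C} F G : computable F -> computable G ->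
  computable (fun g : C => F g ^ G g).
Proof.
apply: comp_app2.
apply: (comp_ext
  (F := fun p => nat_rect (fun _ => nat) 1 (fun _ s => p.1 * s) p.2.1)).
  by move=> [m [n ?]] /=; elim: n => //= n ->; rewrite expnS.
comp.
Qed.

Lemma comp_nat_of_bool C {cC : context C} (F : C -> bool) : computable F ->
  computable (fun g : C => nat_of_bool (F g)).
Proof. exact: comp_encode. Qed.

Lemma comp_if C {cC : context C} A {eA : encoding A} (B : C -> bool)
    (F G : C -> A) : computable B -> computable F -> computable G ->
  computable (fun g : C => if B g then F g else G g).
Proof.
move=> PB PF PG.
apply: (comp_ext (F := fun g => nat_rect (fun _ => A) (G g) (fun _ _ => F g) (B g))).
  by move=> g; case: (B g).
apply: (comp_rec (H := fun _ _ g => F g)) => //.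
by apply: (comp_subst PF); subst_solve.
Qed.

Lemma comp_negb C {cC : context C} F : computable F ->
  computable (fun g : C => ~~ F g).
Proof. by move=> PF; rewrite /negb; apply: comp_if => //; comp. Qed.

Lemma comp_and C {cC : context C} F G : computable F -> computable G ->
  computable (fun g : C => F g && G g).
Proof. by move=> PF PG; rewrite /andb; apply: comp_if => //; comp. Qed.

Lemma comp_or C {cC : context C} F G : computable F -> computable G ->
  computable (fun g : C => F g || G g).
Proof. by move=> PF PG; rewrite /orb; apply: comp_if => //; comp. Qed.

Lemma comp_eq0 C {cC : context C} F : computable F ->
  computable (fun g : C => F g == 0).
Proof.
apply: (comp_app1 (F := eq_op^~ 0)).
apply: (comp_ext
  (F := fun p => nat_rect (fun _ => bool) true (fun _ _ => false) p.1)).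
  by case=> -[].
comp.
Qed.

Lemma comp_leq C {cC : context C} F G : computable F -> computable G ->
  computable (fun g : C => F g <= G g).
Proof. by move=> PF PG; rewrite /leq; apply: comp_eq0; comp. Qed.

Lemma comp_eqn C {cC : context C} (F G : C -> nat) : computable F ->
  computable G -> computable (fun g : C => F g == G g).
Proof.
move=> PF PG; apply: (comp_ext (F := fun g => (F g <= G g) && (G g <= F g))).
  by move=> g; rewrite eqn_leq.
by apply: comp_and; apply: comp_leq.
Qed.

Lemma comp_eqb C {cC : context C} (F G : C -> bool) : computable F ->
  computable G -> computable (fun g : C => F g == G g).
Proof.
move=> PF PG.
apply: (comp_ext (F := fun g => nat_of_bool (F g) == nat_of_bool (G g))).
  by move=> g; case: (F g); case: (G g).
by apply: comp_eqn.
Qed.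

Lemma comp_odd C {cC : context C} F : computable F ->
  computable (fun g : C => odd (F g)).
Proof.
apply: comp_app1.
apply: (comp_ext
  (F := fun p => nat_rect (fun _ => bool) false (fun _ s => ~~ s) p.1)).
  by move=> [n ?] /=; elim: n => //= n ->.
by comp; apply: comp_negb; comp.
Qed.

Lemma comp_iter C {cC : context C} A {eA : encoding A} (H : A -> C -> A)
    (G : C -> A) N :
  computable (fun p : A * C => H p.1 p.2) -> computable G -> computable N ->
  computable (fun g => iter (N g) (fun s => H s g) (G g)).
Proof.
move=> PH PG PN; apply: (comp_ext
  (F := fun g => nat_rect (fun _ => A) (G g) (fun _ s => H s g) (N g))).
  by move=> g; elim: (N g) => //= n ->.
apply: (comp_rec (H := fun _ s g => H s g)) => //.
apply: (comp_subst (S := fun p => (p.2.1, p.2.2)) PH).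
by apply: subst_cons; comp; subst_solve.
Qed.

Ltac step_bool := lazymatch goal with
  | |- computable (fun g => (@?F g) ^ (@?G g)) => apply (@comp_exp _ _ F G)
  | |- computable (fun g => nat_of_bool (@?F g)) => apply (@comp_nat_of_bool _ _ F)
  | |- computable (fun g => if _ then _ else _) => refine (comp_if _ _ _)
  | |- computable (fun g => ~~ @?F g) => apply (@comp_negb _ _ F)
  | |- computable (fun g => @?F g && @?G g) => apply (@comp_and _ _ F G)
  | |- computable (fun g => @?F g || @?G g) => apply (@comp_or _ _ F G)
  | |- computable (fun g => odd (@?F g)) => apply (@comp_odd _ _ F)
  | |- computable (fun g => leq (@?F g) (@?G g)) => apply (@comp_leq _ _ F G)
  | |- computable (fun g => eq_op _ _) => first [ refine (comp_eqn _ _) | refine (comp_eqb _ _) ]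
  | |- computable (fun g => iter (@?N g) (fun s => @?H g s) (@?G g)) =>
     apply (@comp_iter _ _ _ _ (fun s g => H g s) G N)
  | |- _ => step_arith
  end.
Ltac comp_step ::= step_bool.

(** Bounded search by counting: once [k] is at least [m], the sum is [m] itself. Quotients, 2-adic
    valuations and lengths of lists are computed this way. *)
Lemma sum_leq_min (P : nat -> bool) m k :
  (forall i, P i = (i < m)) ->
  nat_rect (fun _ => nat) 0 (fun i s => s + P i) k = minn k m.
Proof. by move=> HP; elim: k => [|k IHk] /=; rewrite ?min0n // IHk HP; lia. Qed.

Lemma comp_div C {cC : context C} F G : computable F -> computable G ->
  computable (fun g : C => F g %/ G g).
Proof.
apply: comp_app2.
(* Counts the positive multiples of the divisor up to the dividend; the guard gives the conventional
   value 0 for a zero divisor. *)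
apply: (comp_ext (F := fun p => nat_rect (fun _ => nat) 0
  (fun i s => s + ((0 < p.2.1) && (i.+1 * p.2.1 <= p.1))) p.1)).
  move=> [m [d ?]] /=.
  have -> := sum_leq_min (m := m %/ d); first by apply/minn_idPr; rewrite leq_div.
  by move=> i; case: d => [|d]; rewrite ?divn0 // leq_divRL.
comp.
Qed.

Lemma comp_mod C {cC : context C} F G : computable F -> computable G ->
  computable (fun g : C => F g %% G g).
Proof.
move=> PF PG; apply: (comp_ext (F := fun g => F g - F g %/ G g * G g)).
  by move=> g; rewrite {1}(divn_eq (F g) (G g)) addKn.
by comp; apply: comp_div.
Qed.

Lemma comp_half C {cC : context C} F : computable F ->
  computable (fun g : C => (F g)./2).
Proof.
move=> PF; apply: (comp_ext (F := fun g => F g %/ 2)).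
  by move=> g; rewrite divn2.
by apply: comp_div; comp.
Qed.

Lemma comp_double C {cC : context C} F : computable F ->
  computable (fun g : C => (F g).*2).
Proof.
move=> PF; apply: (comp_ext (F := fun g => F g + F g)); last by comp.
by move=> g; rewrite addnn.
Qed.

Lemma comp_logn2 C {cC : context C} F : computable F ->
  computable (fun g : C => logn 2 (F g)).
Proof.
apply: comp_app1.
apply: (comp_ext (F := fun p => nat_rect (fun _ => nat) 0
  (fun i s => s + (p.1 %% 2 ^ i.+1 == 0)) p.1)); last first.
  by comp; apply: comp_mod; comp.
move=> [[|m] ?] //; rewrite [LHS](sum_leq_min (m := logn 2 m.+1)) /=.
  apply/minn_idPr; apply: ltnW; apply: leq_trans (ltn_expl _ (isT : 1 < 2)) _.
  by apply: dvdn_leq => //; apply: pfactor_dvdnn.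
by move=> i; rewrite -[_ == 0]/(_ %| _) pfactor_dvdn.
Qed.

Ltac step_div := lazymatch goal with
  | |- computable (fun g => (@?F g) %/ (@?G g)) => apply (@comp_div _ _ F G)
  | |- computable (fun g => (@?F g) %% (@?G g)) => apply (@comp_mod _ _ F G)
  | |- computable (fun g => half (@?F g)) => apply (@comp_half _ _ F)
  | |- computable (fun g => double (@?F g)) => apply (@comp_double _ _ F)
  | |- computable (fun g => logn 2 (@?F g)) => apply (@comp_logn2 _ _ F)
  | |- _ => step_bool
  end.
Ltac comp_step ::= step_div.

(* [CodeSeq.code (a :: s)] is [2 ^ a * (CodeSeq.code s).*2.+1]. *)
Definition code_head (m : nat) := logn 2 m.
Definition code_tail (m : nat) := (m %/ 2 ^ logn 2 m)./2.

Lemma code_headK a s : code_head (CodeSeq.code (a :: s)) = a.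
Proof.
rewrite /code_head /= lognM ?expn_gt0 // pfactorK // lognE.
by rewrite /= dvdn2 /= odd_double addn0.
Qed.

Lemma code_tailK a s : code_tail (CodeSeq.code (a :: s)) = CodeSeq.code s.
Proof.
rewrite /code_tail -/(code_head _) code_headK /= mulKn ?expn_gt0 //.
exact: (half_bit_double _ true).
Qed.

Lemma code_gt0 s : (0 < CodeSeq.code s) = (0 < size s).
Proof. by case: s => //= a s; rewrite muln_gt0 expn_gt0. Qed.

Lemma size_code s : size s <= CodeSeq.code s.
Proof.
elim: s => //= a s IHs; apply: leq_ltn_trans IHs _.
by rewrite -addnn -[in X in X < _](mul1n (CodeSeq.code s)); nia.
Qed.

Lemma comp_code C {cC : context C} A {eA : encoding A} (F : C -> A) :
  computable F -> computable (fun g => encode (F g)).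
Proof. exact: comp_encode. Qed.

(** * Lists and pairs *)

Section Structures.
Context {C : Type} {cC : context C} {A : Type} {eA : encoding A}.

Lemma comp_cons (F : C -> A) (G : C -> seq A) : computable F -> computable G ->
  computable (fun g => F g :: G g).
Proof.
move=> /comp_code PF /comp_code PG.
refine (comp_encode (F := fun g => 2 ^ encode (F g) * (encode (G g)).*2.+1) _ _) => //.
comp.
Qed.

Lemma comp_head (a0 : A) (F : C -> seq A) : computable F ->
  computable (fun g => head a0 (F g)).
Proof.
move=> /comp_code PF; refine (comp_encode (F := fun g =>
  if encode (F g) == 0 then encode a0 else logn 2 (encode (F g))) _ _) => [g|].
  case: (F g) => //= a s; rewrite -(code_headK (encode a) (map encode s)).
  by rewrite ifF //; apply: gtn_eqF; rewrite code_gt0.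
by comp.
Qed.

Lemma comp_behead (F : C -> seq A) : computable F ->
  computable (fun g => behead (F g)).
Proof.
move=> PF; refine (comp_encode (F := fun g => code_tail (encode (F g))) _ _) => [g|].
  by case: (F g) => // a s; apply: code_tailK.
by rewrite /code_tail; comp; apply: comp_code.
Qed.

Lemma comp_nilp (F : C -> seq A) : computable F ->
  computable (fun g => nilp (F g)).
Proof.
move=> PF; refine (comp_ext (F := fun g => encode (F g) == 0) _ _) => [g|].
  by rewrite eqn0Ngt code_gt0 size_map lt0n negbK.
by comp; apply: comp_code PF.
Qed.

End Structures.

Ltac step_list := lazymatch goal with
  | |- computable (fun g => @cons _ _ _) => refine (comp_cons _ _)
  | |- computable (fun g => head ?a _) => refine (comp_head a _)
  | |- computable (fun g => behead _) => refine (comp_behead _)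
  | |- computable (fun g => nilp _) => refine (comp_nilp _)
  | |- computable (fun g => @encode _ _ _) => refine (comp_code _)
  | |- _ => step_div
  end.
Ltac comp_step ::= step_list.

Lemma iter_behead A i (s : seq A) : iter i behead s = drop i s.
Proof. by elim: i s => [|i IHi] [|a s]; rewrite ?drop0 ?iterSr ?IHi. Qed.

Lemma comp_size C {cC : context C} A {eA : encoding A} (F : C -> seq A) :
  computable F -> computable (fun g => size (F g)).
Proof.
apply: comp_app1.
apply: (comp_ext (F := fun p => nat_rect (fun _ => nat) 0
  (fun i n => n + ~~ nilp (iter i (fun s => behead s) p.1)) (encode p.1))).
  move=> [s ?] /=; rewrite (sum_leq_min (m := size s)).
    by apply/minn_idPr; have := size_code (map (@encode _ eA) s); rewrite size_map.
  by move=> i; rewrite iter_behead /nilp size_drop subn_eq0 ltnNge.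
comp.
Qed.

Ltac step_size := lazymatch goal with
  | |- computable (fun g => @size _ _) => refine (comp_size _)
  | |- _ => step_list
  end.
Ltac comp_step ::= step_size.

Lemma comp_foldr C {cC : context C} A {eA : encoding A} B {eB : encoding B}
    (H : A -> B -> C -> B) (z : C -> B) (F : C -> seq A) :
  computable (fun p : A * (B * C) => H p.1 p.2.1 p.2.2) -> computable z ->
  computable F -> computable (fun g => foldr (fun a r => H a r g) (z g) (F g)).
Proof.
(* [head] needs a default element; over an empty type every list is empty and the fold is its
   initial value. *)
move=> PH Pz PF; have [[a0]|nA] := pselect (inhabited A); last first.
  by apply: comp_ext Pz => g; case: (F g) => // a; case: nA.
(* The fold consumes the list from its end, so stage [i] of the recursion reads the entry of index
   [size (F g) - i.+1]. *)
pose nthF i g := head a0 (iter (size (F g) - i.+1) (fun s => behead s) (F g)).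
apply: (comp_ext (F := fun g =>
    nat_rect (fun _ => B) (z g) (fun i r => H (nthF i g) r g) (size (F g)))).
  move=> g; suff rectE i : i <= size (F g) ->
      nat_rect (fun _ => B) (z g) (fun i r => H (nthF i g) r g) i =
      foldr (fun a r => H a r g) (z g) (drop (size (F g) - i) (F g)).
    by rewrite rectE // subnn drop0.
  elim: i => [|i IHi] lei; first by rewrite subn0 drop_size.
  rewrite /= IHi 1?ltnW // /nthF iter_behead.
  rewrite (drop_nth a0 (n := size (F g) - i.+1)); last by lia.
  by rewrite /= subnSK.
apply: (comp_rec (H := fun i r g => H (nthF i g) r g)) => //; last by comp.
have PF2 : computable (fun p : nat * (B * C) => F p.2.2).
  by apply: (comp_subst PF); comp.
apply: (comp_subst (S := fun p => (nthF p.1 p.2.2, (p.2.1, p.2.2))) PH).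
by rewrite /nthF; comp.
Qed.

Section Sequences.
Context {C : Type} {cC : context C} {A : Type} {eA : encoding A}.
Context {B : Type} {eB : encoding B}.

Lemma comp_pair (F : C -> A) (G : C -> B) : computable F -> computable G ->
  computable (fun g => (F g, G g)).
Proof.
move=> PF PG.
by refine (comp_encode (F := fun g => [:: encode (F g); encode (G g)]) _ _); comp.
Qed.

Lemma comp_fst (F : C -> A * B) : computable F -> computable (fun g => (F g).1).
Proof.
move=> /comp_code PF.
refine (comp_encode (F := fun g => code_head (encode (F g))) _ _) => [g|].
  by rewrite code_headK.
by rewrite /code_head; comp.
Qed.

Lemma comp_snd (F : C -> A * B) : computable F -> computable (fun g => (F g).2).
Proof.
move=> /comp_code PF; refine (comp_encode
  (F := fun g => code_head (code_tail (encode (F g)))) _ _) => [g|].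
  by rewrite code_tailK code_headK.
by rewrite /code_head /code_tail; comp.
Qed.

Lemma comp_map (H : A -> C -> B) (F : C -> seq A) :
  computable (fun p : A * C => H p.1 p.2) -> computable F ->
  computable (fun g => [seq H a g | a <- F g]).
Proof.
move=> PH PF.
refine (comp_ext (F := fun g => foldr (fun a r => H a g :: r) [::] (F g)) _ _) => //.
refine (comp_foldr (H := fun a r g => H a g :: r) _ _ _) => //; last by comp.
by comp; apply: (comp_subst (S := fun p => (p.1, p.2.2)) PH); comp.
Qed.

Lemma comp_cat (F G : C -> seq A) : computable F -> computable G ->
  computable (fun g => F g ++ G g).
Proof.
move=> PF PG.
refine (comp_ext (F := fun g => foldr (fun a r => a :: r) (G g) (F g)) _ _).
  by move=> g; elim: (F g) => //= a s ->.
by refine (comp_foldr (H := fun a r g => a :: r) _ _ _); comp.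
Qed.

Lemma comp_count (H : A -> C -> bool) (F : C -> seq A) :
  computable (fun p : A * C => H p.1 p.2) -> computable F ->
  computable (fun g => count (fun a => H a g) (F g)).
Proof.
move=> PH PF.
refine (comp_ext (F := fun g => foldr (fun a r => H a g + r) 0 (F g)) _ _) => //.
refine (comp_foldr (H := fun a r g => H a g + r) _ _ _) => //; last by comp.
by comp; apply: (comp_subst (S := fun p => (p.1, p.2.2)) PH); comp.
Qed.

Lemma comp_has (H : A -> C -> bool) (F : C -> seq A) :
  computable (fun p : A * C => H p.1 p.2) -> computable F ->
  computable (fun g => has (fun a => H a g) (F g)).
Proof.
move=> PH PF.
refine (comp_ext (F := fun g => 0 < count (fun a => H a g) (F g)) _ _) => [g|].
  by rewrite has_count.
by comp; apply: (comp_count PH PF).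
Qed.

Lemma comp_all (H : A -> C -> bool) (F : C -> seq A) :
  computable (fun p : A * C => H p.1 p.2) -> computable F ->
  computable (fun g => all (fun a => H a g) (F g)).
Proof.
move=> PH PF.
refine (comp_ext (F := fun g => ~~ has (fun a => ~~ H a g) (F g)) _ _) => [g|].
  by rewrite -all_predC; apply: eq_all => a /=; rewrite negbK.
by comp; apply: (comp_has (H := fun a g => ~~ H a g)) => //; comp.
Qed.

Lemma comp_eq (T : eqType) {eT : encoding T} (F G : C -> T) : injective eT ->
  computable F -> computable G -> computable (fun g => F g == G g).
Proof.
move=> inj_eT /comp_code PF /comp_code PG.
refine (comp_ext (F := fun g => encode (F g) == encode (G g)) _ _); last by comp.
by move=> g; apply: inj_eq.
Qed.

End Sequences.

Lemma comp_iota C {cC : context C} F G : computable F -> computable G ->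
  computable (fun g : C => iota (F g) (G g)).
Proof.
move=> PF PG; refine (comp_ext (F := fun g =>
  nat_rect (fun _ => seq nat) [::] (fun i s => s ++ [:: F g + i]) (G g)) _ _).
  by move=> g; elim: (G g) => // n IHn; rewrite [LHS]/= IHn -[in RHS]addn1 iotaD.
refine (comp_rec (H := fun i s g => s ++ [:: F g + i]) _ _ _); try by comp.
by apply: comp_cat; comp.
Qed.

Ltac step_seq := lazymatch goal with
  | |- computable (fun g => @pair _ _ _ _) => refine (comp_pair _ _)
  | |- computable (fun g => fst _) => refine (comp_fst _)
  | |- computable (fun g => snd _) => refine (comp_snd _)
  | |- computable (fun g => foldr (fun a r => @?H g a r) _ _) =>
      refine (comp_foldr (H := fun a r g => H g a r) _ _ _)
  | |- computable (fun g => map (fun a => @?H g a) _) =>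
      refine (comp_map (H := fun a g => H g a) _ _)
  | |- computable (fun g => count (fun a => @?H g a) _) =>
      refine (comp_count (H := fun a g => H g a) _ _)
  | |- computable (fun g => has (fun a => @?H g a) _) =>
      refine (comp_has (H := fun a g => H g a) _ _)
  | |- computable (fun g => all (fun a => @?H g a) _) =>
      refine (comp_all (H := fun a g => H g a) _ _)
  | |- computable (fun g => @cat _ _ _) => refine (comp_cat _ _)
  | |- computable (fun g => iota _ _) => refine (comp_iota _ _)
  | |- _ => step_size
  end.
Ltac comp_step ::= step_seq.

Lemma encode_nat_inj : injective encode_nat. Proof. by []. Qed.
Lemma encode_bool_inj : injective encode_bool. Proof. by case=> -[]. Qed.
Lemma encode_ord_inj n : injective (@encode_ord n). Proof. exact: ord_inj. Qed.
Lemma encode_seq_inj A (eA : encoding A) :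
  injective eA -> injective (@encode_seq A eA).
Proof.
move=> injA s s' /(can_inj CodeSeq.codeK); exact: inj_map.
Qed.
Lemma encode_pair_inj A B (eA : encoding A) (eB : encoding B) :
  injective eA -> injective eB -> injective (@encode_pair A B eA eB).
Proof.
move=> injA injB [a b] [a' b'] /(can_inj CodeSeq.codeK)[].
by move=> /injA -> /injB ->.
Qed.

(** * Integers and words *)

Instance encode_int : encoding int :=
  fun x => match x with Posz n => n.*2 | Negz n => n.*2.+1 end.

Lemma encode_int_inj : injective encode_int.
Proof. by move=> [m|m] [n|n] /= mn; (suff -> : m = n by []) || exfalso; lia. Qed.

Ltac encode_inj := repeat first [ assumption | exact encode_nat_inj | exact encode_bool_inj
  | exact encode_int_inj | apply encode_ord_inj
  | apply encode_seq_inj | apply encode_pair_inj ].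

Section Integers.
Context {C : Type} {cC : context C}.
Local Open Scope ring_scope.

Lemma comp_incz (F : C -> int) : computable F -> computable (fun g => F g + 1).
Proof.
move=> /comp_code PF; refine (comp_encode (F := fun g => let m := encode (F g) in
  if odd m then (if m == 1 then 0 else m - 2)%N else (m + 2)%N) _ _) => [g|].
  case: (F g) => [n|[|n]] //.
    have -> : Posz n + 1 = Posz n.+1 by lia.
    by rewrite /encode /= odd_double doubleS addn2.
  have -> : Negz n.+1 + 1 = Negz n by lia.
  by rewrite /encode /= odd_double /= doubleS.
by rewrite /=; comp.
Qed.

Lemma comp_oppz (F : C -> int) : computable F -> computable (fun g => - F g).
Proof.
move=> /comp_code PF; refine (comp_encode (F := fun g => let m := encode (F g) in
  if m == 0%N then 0%N else (if odd m then m + 1 else m - 1)%N) _ _) => [g|].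
  case: (F g) => [[|n]|n] //.
    have -> : - Posz n.+1 = Negz n by lia.
    by rewrite /encode /= odd_double /= subn1.
  have -> : - Negz n = Posz n.+1 by lia.
  by rewrite /encode /= odd_double /= addn1.
by rewrite /=; comp.
Qed.

Lemma comp_decz (F : C -> int) : computable F -> computable (fun g => F g - 1).
Proof.
move=> PF; refine (comp_ext (F := fun g => - (- F g + 1)) _ _) => [g|]; first by lia.
exact (comp_oppz (comp_incz (comp_oppz PF))).
Qed.

End Integers.

Ltac step_int := lazymatch goal with
  | |- computable (fun g => eq_op _ _) =>
       first [ refine (comp_eq _ _ _); [solve [encode_inj] | ..] | step_seq ]
  | |- computable (fun g => (_ + 1)%R) => refine (comp_incz _)
  | |- computable (fun g => (_ - 1)%R) => refine (comp_decz _)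
  | |- computable (fun g => (- _)%R) => refine (comp_oppz _)
  | |- _ => step_seq
  end.
Ltac comp_step ::= step_int.

Section Words.
Variable n : nat.
Local Notation word := (word n.+1).

Lemma word_code_cons a (w : word) :
  word_code (a :: w) = (2 * n.+1 * word_code w + (2 * a.1 + a.2 + 1))%N.
Proof. by []. Qed.

Lemma comp_word_code C {cC : context C} (F : C -> word) : computable F ->
  computable (fun g => word_code (F g)).
Proof.
move=> PF; refine (comp_ext (F := fun g =>
  foldr (fun a m => 2 * n.+1 * m + (2 * encode a.1 + encode a.2 + 1)) 0 (F g)) _ _) => //.
comp.
Qed.

(** Splits off the first letter, which is the least significant digit. Digits start at 1, hence the
    predecessor before the division. The code 0 of the empty word is a fixed point, so iterating too
    often does no harm. *)
Definition undigit (s : nat * seq (nat * bool)) : nat * seq (nat * bool) :=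
  if s.1 == 0 then s else
  (s.1.-1 %/ (2 * n.+1),
   s.2 ++ [:: ((s.1.-1 %% (2 * n.+1))./2, odd (s.1.-1 %% (2 * n.+1)))]).

Lemma undigit_word_code k (w : word) s : size w <= k ->
  iter k undigit (word_code w, s) = (0, s ++ [seq (nat_of_ord a.1, a.2) | a <- w]).
Proof.
elim: k w s => [|k IHk] [|[i b] w] s; rewrite ?cats0 //.
  by move=> _; rewrite iterSr /undigit /= (IHk [::] s) // cats0.
move=> lewk; rewrite iterSr word_code_cons {2}/undigit /=.
rewrite addn1 addnS /=; have lt_d : 2 * i + b < 2 * n.+1.
  by have := ltn_ord i; lia.
rewrite mulnC divnMDl // divn_small // addn0 modnMDl modn_small //.
rewrite IHk // -catA /=; congr (_, _ ++ _ :: _).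
by rewrite mul2n addnC half_bit_double oddD odd_double addbF oddb.
Qed.

Lemma size_word_code (w : word) : size w <= word_code w.
Proof.
elim: w => // a w IHw; rewrite word_code_cons /=; nia.
Qed.

Lemma comp_undigit C {cC : context C} (F : C -> nat * seq (nat * bool)) :
  computable F -> computable (fun g => undigit (F g)).
Proof. move=> PF; rewrite /undigit; comp. Qed.

(** With [comp_word_code], this makes the numeration of words in the statement interchangeable with
    the list encoding on which the programs work. *)
Lemma comp_word_decode C {cC : context C} (F : C -> word) :
  computable (fun g => word_code (F g)) -> computable F.
Proof.
move=> PF; refine (comp_encode (F := fun g =>
  (iter (word_code (F g)) (fun s => undigit s) (word_code (F g), [::])).2) _ _).
  move=> g; rewrite undigit_word_code ?size_word_code //=.
  by rewrite /encode /encode_seq -map_comp; congr CodeSeq.code.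
by comp; apply: comp_undigit; comp.
Qed.

End Words.

Lemma comp_mem C {cC : context C} (T : eqType) {eT : encoding T} (F : C -> T)
    (G : C -> seq T) : injective eT -> computable F -> computable G ->
  computable (fun g => F g \in G g).
Proof.
move=> inj_eT PF PG.
refine (comp_ext (F := fun g => has (fun a => a == F g) (G g)) _ _) => [g|].
  exact: has_pred1.
by comp.
Qed.

Lemma comp_nth C {cC : context C} A {eA : encoding A} (a0 : A)
    (F : C -> seq A) (G : C -> nat) : computable F -> computable G ->
  computable (fun g => nth a0 (F g) (G g)).
Proof.
move=> PF PG.
refine (comp_ext (F := fun g =>
  head a0 (iter (G g) (fun s => behead s) (F g))) _ _); last by comp.
by move=> g; rewrite iter_behead -nth0 nth_drop addn0.
Qed.

Lemma comp_code_seq C {cC : context C} (F : C -> seq nat) :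
  computable F -> computable (fun g => CodeSeq.code (F g)).
Proof. by apply: comp_encode => g; rewrite [LHS]/encode /encode_seq map_id. Qed.

Lemma comp_decode C {cC : context C} (F : C -> nat) :
  computable F -> computable (fun g => CodeSeq.decode (F g)).
Proof.
by apply: comp_encode => g; rewrite [RHS]/encode /encode_seq map_id CodeSeq.decodeK.
Qed.

Ltac step_coding := lazymatch goal with
  | |- computable (fun g => in_mem _ _) => refine (comp_mem _ _ _); [encode_inj | ..]
  | |- computable (fun g => nth ?a _ _) => refine (comp_nth a _ _)
  | |- computable (fun g => CodeSeq.code _) => refine (comp_code_seq _)
  | |- computable (fun g => CodeSeq.decode _) => refine (comp_decode _)
  | |- _ => step_int
  end.
Ltac comp_step ::= step_coding.

(** * A recursive relation with a nonrecursive projection *)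

Section Universal.
Local Arguments CodeSeq.code : simpl never.
Local Notation code := CodeSeq.code.
Local Notation decode := CodeSeq.decode.

(* The nodes tagged 4 and 5 form the list of the inner functions of a
   composition. *)
Fixpoint recfun_code k (f : recfun k) : nat :=
  match f with
  | RZero _ => code [:: 0]
  | RSucc => code [:: 1]
  | RProj _ i => code [:: 2; nat_of_ord i]
  | RComp _ m g h => code [:: 3; recfun_code g;
      foldr (fun c r => code [:: 5; c; r]) (code [:: 4])
        (map (fun i => recfun_code (h i)) (enum 'I_m))]
  | RPrec _ g h => code [:: 6; recfun_code g; recfun_code h]
  | RMin _ g => code [:: 7; recfun_code g]
  end.

(* Codes the assertion that the function coded by [e] maps [x] to [y]. *)
Definition judgement (e : nat) (x : seq nat) (y : nat) := code [:: e; code x; y].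
Definition output (t : nat) := nth 0 (decode t) 2.

(* [derives L e l x y]: with [l] the node coded by [e], the judgement
   [judgement e x y] follows in one step from judgements in [L]. *)
Definition derives (L : seq nat) (e : nat) (l x : seq nat) (y : nat) : bool :=
  let tag := nth 0 l 0 in let a := nth 0 l 1 in let b := nth 0 l 2 in
  if tag == 0 then y == 0 else
  if tag == 1 then y == (head 0 x).+1 else
  if tag == 2 then y == nth 0 x a else
  if tag == 3 then
    has (fun t => (t == judgement b x (output t)) &&
                  (judgement a (decode (output t)) y \in L)) L else
  if tag == 4 then y == 0 else
  if tag == 5 then
    [&& y != 0, judgement a x (head 0 (decode y)) \in L
      & judgement b x (code (behead (decode y))) \in L] else
  if tag == 6 then
    if head 0 x == 0 then judgement a (behead x) y \in L else
    has (fun t =>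
      (t == judgement e ((head 0 x).-1 :: behead x) (output t)) &&
      (judgement b ((head 0 x).-1 :: output t :: behead x) y \in L)) L else
  (judgement a (y :: x) 0 \in L) &&
  all (fun i => has (fun t =>
    (t == judgement a (i :: x) (output t)) && (0 < output t)) L) (iota 0 y).

Definition justified (L : seq nat) (t : nat) : bool :=
  derives L (nth 0 (decode t) 0) (decode (nth 0 (decode t) 0))
    (decode (nth 0 (decode t) 1)) (output t).

(** A derivation is a list without any order. For the code of a function no circular justification
    can arise: a premise concerns a proper part of the function or, in primitive recursion, a
    smaller argument. *)
Definition closed (L : seq nat) := all (fun t => justified L t) L.

(** Kleene's T predicate on the diagonal, restricted to the output 0; [c] codes the derivation. *)
Definition halts_with_0 (e c : nat) : bool :=
  closed (decode c) && (judgement e [:: e] 0 \in decode c).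

Lemma comp_halts_with_0 :
  computable (fun p : nat * (nat * unit) => halts_with_0 p.1 p.2.1).
Proof.
rewrite /halts_with_0 /closed /justified /derives /judgement /output; comp.
Qed.

Lemma output_judgement e x y : output (judgement e x y) = y.
Proof. by rewrite /output CodeSeq.codeK. Qed.

Lemma justified_judgement L l x y :
  justified L (judgement (code l) x y) = derives L (code l) l x y.
Proof. by rewrite /justified output_judgement /judgement !CodeSeq.codeK. Qed.

(** An intermediate value in a premise is looked for among the outputs of the finite list [L], which
    keeps [derives] computable. *)
Lemma has_judgement (P : pred nat) L e x :
  reflect (exists2 z, judgement e x z \in L & P z)
    (has (fun t => (t == judgement e x (output t)) && P (output t)) L).
Proof.
apply: (iffP hasP) => [[t tL /andP[/eqP tE Pt]]|[z zL Pz]].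
  by exists (output t) => //; rewrite -tE.
by exists (judgement e x z); rewrite // output_judgement eqxx.
Qed.

Lemma closedP L l x y : closed L -> judgement (code l) x y \in L ->
  derives L (code l) l x y.
Proof. by move=> /allP cL /cL; rewrite justified_judgement. Qed.
Arguments derives L e l x y /.

Lemma recfun_sound L k (f : recfun k) (x : k.-tuple nat) y :
  closed L -> judgement (recfun_code f) x y \in L -> computes f x y.
Proof.
move=> cL; elim: f x y => {k} [k||k i|k m g IHg h IHh|k g IHg h IHh|k g IHg] x y /=.
- by move=> /(closedP cL) /= /eqP.
- move=> /(closedP cL) /= /eqP ->.
  by case/tupleP: x => i x; rewrite theadE.
- by move=> /(closedP cL) /= /eqP ->; rewrite (tnth_nth 0).
- move=> /(closedP cL) /= /(has_judgement
    (fun z => judgement (recfun_code g) (decode z) y \in L))[z zL gL].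
  suff [zs zE hzs] : exists2 zs : 'I_m -> nat, z = code (map zs (enum 'I_m)) &
      forall i, i \in enum 'I_m -> computes (h i) x (zs i).
    exists [tuple zs i | i < m] => [i|]; first by rewrite tnth_mktuple; apply: hzs; rewrite mem_enum.
    by apply: IHg; move: gL; rewrite zE CodeSeq.codeK.
  (* Descends along the nodes tagged 5. As the enumeration has no repetition, the value at [i] can
     be set without disturbing the values at later indices. *)
  elim: (enum 'I_m) (enum_uniq 'I_m) z zL {gL} => [|i s IHs] /=.
    by move=> _ z /(closedP cL) /= /eqP ->; exists (fun _ => 0).
  move=> /andP[is_ us] z /(closedP cL) /= /and3P[z0 iL].
  move=> /(IHs us)[zs zE hzs]; exists (fun j => if j == i then head 0 (decode z) else zs j).
    rewrite eqxx; have -> : [seq (if j == i then head 0 (decode z) else zs j) | j <- s]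
        = [seq zs j | j <- s].
      apply/eq_in_map => j js; case: eqP => // ji.
      by rewrite -ji js in is_.
    rewrite -[[seq zs j | j <- s]]CodeSeq.codeK -zE CodeSeq.codeK.
    rewrite -{1}[z]CodeSeq.decodeK; case E: (decode z) => [|v vs] //.
    by rewrite -[z]CodeSeq.decodeK E in z0.
  move=> j; rewrite inE; case: eqP => [-> _|_ /hzs //].
  exact: IHh.
- case/tupleP: x => i x; rewrite theadE => yL.
  have -> : [tuple of behead [tuple of i :: x]] = x by apply: val_inj.
  set e := code _ in yL.
  have [s [s0 sS yE]] : exists s : nat -> nat, [/\ computes g x (s 0),
      forall j, j < i -> computes h [tuple of j :: s j :: x] (s j.+1) & y = s i].
    elim: i y yL => [|i IHi] y /(closedP cL).
      by rewrite /derives /= => /IHg; exists (fun _ => y).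
    move=> /= /(has_judgement (fun z =>
      judgement (recfun_code h) (i :: z :: x) y \in L))[z zL hL]; have [s [s0 sS zE]] := IHi _ zL.
    exists (fun j => if j <= i then s j else y); split=> //; last by rewrite ltnn.
    move=> j; rewrite ltnS => ji; rewrite ji; case: ltnP => [/sS //|ij].
    have -> : j = i by apply/eqP; rewrite eqn_leq ji.
    by apply: IHh; rewrite -zE.
  exists s; split=> // j ji.
  by have := sS _ ji; congr (computes h _ _); apply: val_inj.
- move=> /(closedP cL) /= /andP[yL /allP yS]; split; first exact: IHg.
  move=> i iy; have /yS : i \in iota 0 y by rewrite mem_iota.
  move=> /(has_judgement (fun z => 0 < z))[[|z] zL //= _].
  by exists z; exact: IHg.
Qed.

(** Membership in the list occurs only positively in [derives]. Hence closed lists can be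
    concatenated and premises derived separately can be brought together. *)
Lemma justified_sub L L' t : {subset L <= L'} -> justified L t -> justified L' t.
Proof.
move=> LL'; rewrite /justified /derives /=; set e := nth 0 _ 0; set x := decode _.
do 3![case: ifP => // _].
have subh (P Q : pred nat) : (forall t, P t -> Q t) -> has P L -> has Q L'.
  by move=> PQ /hasP[s /LL' sL /PQ Qs]; apply/hasP; exists s.
case: ifP => _; first by apply: subh => s /andP[-> /LL'].
case: ifP => // _.
case: ifP => _; first by move=> /and3P[-> /LL' -> /LL' ->].
case: ifP => _.
  case: ifP => _; first exact: LL'.
  by apply: subh => s /andP[-> /LL'].
move=> /andP[/LL' -> /allP yS]; apply/allP => i /yS; exact: subh.
Qed.

Lemma closed_cat L L' : closed L -> closed L' -> closed (L ++ L').
Proof.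
rewrite /closed all_cat => /allP cL /allP cL'; apply/andP; split; apply/allP => t.
  by move=> /cL; apply: justified_sub => s; rewrite mem_cat => ->.
by move=> /cL'; apply: justified_sub => s; rewrite mem_cat orbC => ->.
Qed.

Lemma closed_cons L t : closed L -> justified L t -> closed (t :: L).
Proof.
have LtL : {subset L <= t :: L} by move=> s; rewrite inE orbC => ->.
move=> /allP cL tL; apply/andP; split; first exact: justified_sub tL.
by apply/allP => s /cL; apply: justified_sub.
Qed.

Definition derivable e x y := exists2 L, closed L & judgement e x y \in L.

Lemma derivable_step L l x y :
  closed L -> derives L (code l) l x y -> derivable (code l) x y.
Proof.
rewrite -justified_judgement => cL dL.
by exists (judgement (code l) x y :: L); [exact: closed_cons | rewrite mem_head].
Qed.

Lemma derivable2 e x y e' x' y' : derivable e x y -> derivable e' x' y' ->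
  exists L, [/\ closed L, judgement e x y \in L & judgement e' x' y' \in L].
Proof.
move=> [L cL eL] [L' cL' eL']; exists (L ++ L'); split; first exact: closed_cat.
  by rewrite mem_cat eL.
by rewrite mem_cat eL' orbT.
Qed.

Lemma recfun_complete k (f : recfun k) (x : k.-tuple nat) y :
  computes f x y -> derivable (recfun_code f) x y.
Proof.
elim: f x y => {k} [k||k i|k m g IHg h IHh|k g IHg h IHh|k g IHg] x y /=.
- by move=> ->; apply: (derivable_step (L := [::])).
- by case/tupleP: x => i x; rewrite theadE => ->; apply: (derivable_step (L := [::])) => //=.
- by move=> ->; apply: (derivable_step (L := [::])) => //=; rewrite (tnth_nth 0).
- move=> [z hz gz].
  have hsz : derivable (foldr (fun c r => code [:: 5; c; r]) (code [:: 4])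
      [seq recfun_code (h i) | i <- enum 'I_m]) x
      (code [seq tnth z i | i <- enum 'I_m]).
    elim: (enum 'I_m) => [|i s IHs] /=; first exact: (derivable_step (L := [::])).
    have [L [cL iL sL]] := derivable2 (IHh _ _ _ (hz i)) IHs.
    apply: (derivable_step cL) => /=; rewrite !CodeSeq.codeK /= iL sL !andbT.
    by rewrite -lt0n code_gt0.
  have [L [cL gL hL]] := derivable2 (IHg _ _ gz) hsz.
  apply: (derivable_step cL) => /=; apply/(has_judgement
    (fun z => judgement (recfun_code g) (decode z) y \in L)).
  exists (code [seq tnth z i | i <- enum 'I_m]) => //.
  by rewrite CodeSeq.codeK map_tnth_enum.
- case/tupleP: x => n x; rewrite theadE => -[s].
  have -> : [tuple of behead [tuple of n :: x]] = x by apply: val_inj.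
  move=> [s0 sS ->]; have {sS} : forall i, i < n ->
      computes h [tuple of i :: s i :: x] (s i.+1).
    by move=> i /sS; congr (computes h _ _); apply: val_inj.
  elim: n => [_|n IHn sS].
    have [L cL gL] := IHg _ _ s0.
    exact: (derivable_step cL).
  have [L [cL gL hL]] := derivable2 (IHn (fun i lt_i => sS i (leqW lt_i)))
    (IHh _ _ (sS n (leqnn _))).
  apply: (derivable_step cL) => /=; apply/(has_judgement (fun z =>
    judgement (recfun_code h) (n :: z :: x) (s n.+1) \in L)).
  by exists (s n).
- move=> [y0 yS].
  (* Minimization has one premise for each argument below [y]; their derivations are merged into a
     single closed list. *)
  have [L cL hL] : exists2 L, closed L & forall i, i < y ->
      exists z, judgement (recfun_code g) (i :: x) z.+1 \in L.
    elim: y yS {y0} => [|y IHy] yS; first by exists [::].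
    have [L cL hL] := IHy (fun i iy => yS i (leqW iy)).
    have [z /IHg[L' cL' zL']] := yS y (leqnn _).
    exists (L ++ L') => [|i]; first exact: closed_cat.
    rewrite ltnS leq_eqVlt => /orP[/eqP ->|/hL[w wL]].
      by exists z; rewrite mem_cat zL' orbT.
    by exists w; rewrite mem_cat wL.
  have [L' cL' yL'] := IHg _ _ y0.
  apply: (derivable_step (closed_cat cL' cL)) => /=.
  rewrite mem_cat yL' /=; apply/allP => i; rewrite mem_iota => /hL[z zL].
  apply/(has_judgement (fun z => 0 < z)); exists z.+1 => //.
  by rewrite mem_cat zL orbT.
Qed.

(** Diagonal argument: a decision function [f] applied to its own code returns 0, the code of
    [false], iff a derivation of that very value exists, that is, iff the correct answer is
    [true]. *)
Lemma halting_undecidable : ~ computable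
  (fun p : nat * unit => `[< exists c, halts_with_0 p.1 c >]).
Proof.
case=> f Pf; have := Pf (recfun_code f, tt).
set x := vals _; have xE : x = [:: recfun_code f] :> seq nat by [].
case: asboolP => [[c /andP[cL]]|nh];
  rewrite /encode /encode_bool /= -?xE.
  by move=> /(recfun_sound cL) f0 /(computes_functional f0).
move=> /recfun_complete[L cL fL]; case: nh; exists (code L).
by rewrite /halts_with_0 CodeSeq.codeK cL -xE.
Qed.

End Universal.

Lemma undecidable_projection : exists T : nat -> nat -> bool,
  computable (fun p : nat * (nat * unit) => T p.1 p.2.1) /\
  ~ computable (fun p : nat * unit => `[< exists c, T p.1 c >]).
Proof.
by exists halts_with_0; split; [exact: comp_halts_with_0 | exact: halting_undecidable].
Qed.

Local Open Scope group_scope.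
Local Open Scope quotient_scope.

(** * Free groups and groups of bijections *)

Section Morphisms.
Variables (G H : groupType) (f : {multiplicative G -> H}).

Lemma multiplicative1 : f 1 = 1.
Proof. by apply: (mulgI (f 1)); rewrite -gmulfM !mulg1. Qed.

Lemma multiplicativeV x : f x^-1 = (f x)^-1.
Proof. by apply: (mulgI (f x)); rewrite -gmulfM !mulgV multiplicative1. Qed.

End Morphisms.

Section Words.
Variable n : nat.
Implicit Types (u v w : word n).

Definition word_inv w : word n := foldr (fun a r => r ++ [:: (a.1, ~~ a.2)]) [::] w.
Definition word_exp w k : word n := iter k (fun s => w ++ s) [::].

Lemma word_value_nil (G : groupType) (X : 'I_n -> G) : word_value X [::] = 1.
Proof. exact: big_nil. Qed.

Lemma word_value_cons (G : groupType) (X : 'I_n -> G) a w :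
  word_value X (a :: w) = (if a.2 then (X a.1)^-1 else X a.1) * word_value X w.
Proof. exact: big_cons. Qed.

Lemma word_value_cat (G : groupType) (X : 'I_n -> G) u v :
  word_value X (u ++ v) = word_value X u * word_value X v.
Proof. exact: big_cat. Qed.

Lemma word_value_inv (G : groupType) (X : 'I_n -> G) w :
  word_value X (word_inv w) = (word_value X w)^-1.
Proof.
elim: w => [|[i b] w IHw] /=; first by rewrite !word_value_nil invg1.
rewrite word_value_cat IHw !word_value_cons word_value_nil mulg1 invgM /=.
by case: b; rewrite /= ?invgK.
Qed.

Lemma word_value_exp (G : groupType) (X : 'I_n -> G) w k :
  word_value X (word_exp w k) = word_value X w ^+ k.
Proof.
elim: k => [|k IHk]; first exact: word_value_nil.
by rewrite /= word_value_cat IHk expgS.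
Qed.

Lemma word_value_morph (G H : groupType) (f : {multiplicative G -> H})
    (X : 'I_n -> G) w : f (word_value X w) = word_value (fun i => f (X i)) w.
Proof.
elim: w => [|[i b] w IHw]; first by rewrite !word_value_nil multiplicative1.
by rewrite !word_value_cons gmulfM IHw; case: b; rewrite //= multiplicativeV.
Qed.

End Words.

Section FreeGroup.
Variable n : nat.

(* Quantifying over all groups makes the universal property immediate and spares
   any reduction of words. *)
Definition word_eq : rel (word n) := fun u v =>
  `[< forall (G : groupType) (X : 'I_n -> G), word_value X u = word_value X v >].

Fact word_eq_refl : reflexive word_eq.
Proof. by move=> u; apply/asboolP. Qed.

Fact word_eq_sym : symmetric word_eq.
Proof. by move=> u v; apply/asboolP/asboolP => uv G X; rewrite uv. Qed.

Fact word_eq_trans : transitive word_eq.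
Proof.
by move=> v u w /asboolP uv /asboolP vw; apply/asboolP => G X; rewrite uv.
Qed.

Canonical word_equiv := EquivRel word_eq word_eq_refl word_eq_sym word_eq_trans.

Definition free_group := {eq_quot word_equiv}.
HB.instance Definition _ := Choice.on free_group.
HB.instance Definition _ := EqQuotient.on free_group.

Definition free_one : free_group := \pi_free_group ([::] : word n).
Definition free_mul (x y : free_group) : free_group  := \pi_free_group (repr x ++ repr y : word n).
Definition free_inv (x : free_group) : free_group  := \pi_free_group (word_inv (repr x)).

Definition free_eval (G : groupType) (X : 'I_n -> G) (x : free_group) : G :=
  word_value X (repr x).

Lemma free_eval_pi (G : groupType) (X : 'I_n -> G) u :
  free_eval X (\pi_free_group u) = word_value X u.
Proof.
rewrite /free_eval; have : word_eq (repr (\pi_free_group u)) u.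
  by rewrite -[word_eq _ _]/(word_equiv _ _) -eqmodE reprK.
by move/asboolP.
Qed.

Lemma free_group_eq (x y : free_group) :
  (forall (G : groupType) (X : 'I_n -> G), free_eval X x = free_eval X y) -> x = y.
Proof.
by move=> xy; rewrite -[x]reprK -[y]reprK; apply/eqmodP/asboolP.
Qed.

Lemma free_eval_mul (G : groupType) (X : 'I_n -> G) x y :
  free_eval X (free_mul x y) = free_eval X x * free_eval X y.
Proof. by rewrite free_eval_pi word_value_cat. Qed.

Lemma free_eval_inv (G : groupType) (X : 'I_n -> G) x :
  free_eval X (free_inv x) = (free_eval X x)^-1.
Proof. by rewrite free_eval_pi word_value_inv. Qed.

Lemma free_eval_one (G : groupType) (X : 'I_n -> G) : free_eval X free_one = 1.
Proof. by rewrite free_eval_pi word_value_nil. Qed.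

Fact free_mulA : associative free_mul.
Proof. by move=> x y z; apply: free_group_eq => G X; rewrite !free_eval_mul mulgA. Qed.
Fact free_mul1 : left_id free_one free_mul.
Proof. by move=> x; apply: free_group_eq => G X; rewrite free_eval_mul free_eval_one mul1g. Qed.
Fact free_1mul : right_id free_one free_mul.
Proof. by move=> x; apply: free_group_eq => G X; rewrite free_eval_mul free_eval_one mulg1. Qed.
Fact free_mulV : left_inverse free_one free_inv free_mul.
Proof.
move=> x; apply: free_group_eq => G X.
by rewrite free_eval_mul free_eval_inv free_eval_one mulVg.
Qed.
Fact free_Vmul : right_inverse free_one free_inv free_mul.
Proof.
move=> x; apply: free_group_eq => G X.
by rewrite free_eval_mul free_eval_inv free_eval_one mulgV.
Qed.

HB.instance Definition _ := isGroup.Build free_group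
  free_mulA free_mul1 free_1mul free_mulV free_Vmul.

Definition free_gen (i : 'I_n) : free_group := \pi_free_group ([:: (i, false)] : word n).

Lemma free_eval_gen (G : groupType) (X : 'I_n -> G) i : free_eval X (free_gen i) = X i.
Proof. by rewrite free_eval_pi word_value_cons word_value_nil mulg1. Qed.

Lemma free_word_value u : word_value free_gen u = \pi_free_group u.
Proof.
apply: free_group_eq => G X; rewrite free_eval_pi.
elim: u => [|[i b] u IHu]; first by rewrite !word_value_nil; exact: free_eval_one.
rewrite !word_value_cons [LHS]free_eval_mul IHu; congr (_ * _).
by case: b => /=; rewrite ?[LHS]free_eval_inv free_eval_gen.
Qed.

Lemma free_group_gen (x : free_group) : exists u, x = word_value free_gen u.
Proof. by exists (repr x); rewrite free_word_value reprK. Qed.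

Lemma free_group_basis : free_basis free_gen.
Proof.
move=> G f.
pose cM := isMultiplicative.Build free_group G (free_eval f) (@free_eval_mul G f).
pose phi : {multiplicative free_group -> G} := HB.pack (free_eval f) cM.
exists phi => [i|psi psiX x]; first exact: free_eval_gen.
have [u ->] := free_group_gen x.
rewrite word_value_morph /= free_word_value free_eval_pi.
by congr word_value; apply: funext.
Qed.

End FreeGroup.

Section Bijections.
Variable T : Type.

Record bijection := Bijection {
  bij_fun :> T -> T;
  bij_inv : T -> T;
  bij_funK : cancel bij_fun bij_inv;
  bij_invK : cancel bij_inv bij_fun }.

HB.instance Definition _ := gen_eqMixin bijection.
HB.instance Definition _ := gen_choiceMixin bijection.

Lemma bijection_eq (f g : bijection) : f =1 g -> f = g.
Proof.
case: f g => [f f' fK f'K] [g g' gK g'K] /= /funext fg.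
move: g' gK g'K; rewrite -fg => g' gK g'K.
have E : f' = g' by apply: funext => x; rewrite -[in RHS](f'K x) gK.
by move: gK g'K; rewrite -E => gK g'K; congr Bijection; exact: Prop_irrelevance.
Qed.

Definition bij_one := @Bijection id id (fun _ => erefl) (fun _ => erefl).
(** The left factor acts first, so that a word is executed from left to right. *)
Definition bij_mul (f g : bijection) :=
  @Bijection (g \o f) (bij_inv f \o bij_inv g)
    (can_comp (@bij_funK g) (@bij_funK f)) (can_comp (@bij_invK f) (@bij_invK g)).
Definition bij_opp (f : bijection) := Bijection (@bij_invK f) (@bij_funK f).

Fact bij_mulA : associative bij_mul. Proof. by move=> f g h; apply: bijection_eq. Qed.
Fact bij_1mul : left_id bij_one bij_mul. Proof. by move=> f; apply: bijection_eq. Qed.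
Fact bij_mul1 : right_id bij_one bij_mul. Proof. by move=> f; apply: bijection_eq. Qed.
Fact bij_Vmul : left_inverse bij_one bij_opp bij_mul.
Proof. by move=> f; apply: bijection_eq => x /=; exact: bij_invK. Qed.
Fact bij_mulV : right_inverse bij_one bij_opp bij_mul.
Proof. by move=> f; apply: bijection_eq => x /=; exact: bij_funK. Qed.

HB.instance Definition _ := isGroup.Build bijection
  bij_mulA bij_1mul bij_mul1 bij_Vmul bij_mulV.

End Bijections.

(** * Commutators and flows in Schreier graphs *)

Section Subgroups.
Variable G : groupType.
Implicit Types (S : G -> Prop) (x y : G).

Definition subgroup S :=
  [/\ S 1, forall x y, S x -> S y -> S (x * y) & forall x, S x -> S x^-1].

(** Counterpart of [derived] for a subgroup that need not be normal, as is the case of [N<v>]. *)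
Definition commutators S x :=
  forall H : G -> Prop, subgroup H ->
    (forall a b, S a -> S b -> H [~ a, b]) -> H x.

Lemma subgroup_commutators S : subgroup (commutators S).
Proof.
split=> [H [H1 _ _] _ //|x y xS yS H sH HS|x xS H sH HS]; case: (sH) => H1 HM HV.
  by apply: HM; [exact: xS | exact: yS].
by apply: HV; exact: xS.
Qed.

Lemma commutators_in S x y : S x -> S y -> commutators S [~ x, y].
Proof. by move=> xS yS H _; apply. Qed.

Lemma commutators_min S (H : G -> Prop) : subgroup H ->
  (forall a b, S a -> S b -> H [~ a, b]) -> forall x, commutators S x -> H x.
Proof. by move=> sH HS x xS; apply: xS. Qed.

Lemma commutators_sub S x : subgroup S -> commutators S x -> S x.
Proof.
move=> sS; apply: commutators_min => // a b aS bS; have [_ SM SV] := sS.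
by rewrite /commg /conjg; apply: SM (SV _ aS) (SM _ _ (SV _ bS) (SM _ _ aS bS)).
Qed.

Lemma commutators_mono S S' x :
  (forall y, S y -> S' y) -> commutators S x -> commutators S' x.
Proof.
move=> SS'; apply: commutators_min; first exact: subgroup_commutators.
by move=> a b /SS' aS /SS' bS; exact: commutators_in.
Qed.

Lemma commutators_conj S x s : subgroup S -> S s -> commutators S x ->
  commutators S (s * x * s^-1).
Proof.
move=> sS Ss xS; have [S1 SM SV] := sS; have [D1 DM DV] := subgroup_commutators S.
have -> : s * x * s^-1 = x * [~ x, s^-1] by rewrite /commg /conjg invgK !mulgA mulgV mul1g.
by apply: DM => //; apply: commutators_in; [exact: commutators_sub | exact: SV].
Qed.

Lemma derivedP (N : normalSubgroup G) x :
  reflect (commutators (fun y => y \in N) x) (x \in derived N).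
Proof.
apply: (iffP idP) => [/asboolP xN H sH HN|xN]; last first.
  apply/asboolP => H HN; apply: (xN (fun y => y \in H)) => //.
  by split; [exact: gpred1 | move=> a b; exact: gpredM | move=> a; rewrite gpredV].
have [H1 HM HV] := sH.
pose K : {pred G} := fun z => `[< H z >].
have KM : mulg_closed K by move=> u v /asboolP Hu /asboolP Hv; apply/asboolP; exact: HM.
have K1 : 1 \in K by apply/asboolP.
have KV : invg_closed K by move=> u /asboolP Hu; apply/asboolP; exact: HV.
pose cM := isMulClosed.Build G K KM.
pose c1 := isMul1Closed.Build G K K1.
pose cV := isInvClosed.Build G K KV.
pose K' : groupClosed G := HB.pack K cM c1 cV.
by apply/asboolP; apply: (xN K') => a b aN bN; apply/asboolP; exact: HN.
Qed.

(* A word, with the letter [(true, e)] standing for the inverse of [c e]. *)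
Definition letter_value (E : Type) (c : E -> G) (a : bool * E) : G :=
  if a.1 then (c a.2)^-1 else c a.2.
Arguments letter_value : simpl never.

(** Modulo commutators the letters commute, so the first letter can be cancelled against an
    occurrence of its inverse; the remaining word is shorter and still balanced. *)
Lemma balanced_commutators (E : eqType) (c : E -> G) S (s : seq (bool * E)) :
  subgroup S -> (forall e, S (c e)) ->
  (forall e, count_mem (true, e) s = count_mem (false, e) s) ->
  commutators S (\prod_(a <- s) letter_value c a).
Proof.
move=> sS Sc; have [D1 DM DV] := subgroup_commutators S; have [S1 SM SV] := sS.
have [k] := ubnP (size s); elim: k s => // k IHk [|[b e] s] /= ltk bal.
  by rewrite big_nil.
have es : (~~ b, e) \in s.
  rewrite -has_pred1 has_count; have := bal e; rewrite /= !xpair_eqE !eqxx.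
  by case: b {ltk bal} => /=; lia.
case/splitPr: es ltk bal => s1 s2; rewrite size_cat /= => ltk bal.
rewrite big_cons big_cat big_cons /= mulgA.
have Sl1 a : S (letter_value c a) by case: a => -[] a; [exact: SV | exact: Sc].
have Sl r : S (\prod_(a <- r) letter_value c a).
  by elim: r => [|a r IHr]; rewrite ?big_nil ?big_cons //; exact: SM.
set p1 := \prod_(a <- s1) letter_value c a.
set p2 := \prod_(a <- s2) letter_value c a.
pose x := letter_value c (b, e).
have -> : letter_value c (~~ b, e) = x^-1 by rewrite /x /letter_value; case: b {ltk bal x}; rewrite ?invgK.
have -> : x * p1 * (x^-1 * p2) = [~ x^-1, p1^-1] * (p1 * p2).
  by rewrite /commg /conjg !invgK !mulgA mulgVK.
apply: DM; first by apply: commutators_in; apply: SV; [exact: Sl1 | exact: Sl].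
rewrite -big_cat; apply: IHk; first by rewrite size_cat; lia.
move=> f; have := bal f; rewrite /= !count_cat /= !xpair_eqE.
by case: b {ltk bal x} => /=; case: (e == f) => /=; lia.
Qed.

End Subgroups.

(* The abelian-by-cyclic case: a commutator of two elements of [A <v>] has the form
   [[a^-1, v^-1]] with [a] in the abelian normal subgroup [A]. *)
Section AbelianByCyclic.
Variables (G : groupType) (A : G -> Prop) (v : G).
Hypotheses (sA : subgroup A) (nA : forall x y, A x -> A (x ^ y)).
Hypothesis cA : forall x y, A x -> A y -> commute x y.

Definition twisted x := exists2 a, A a & x = a * v * a^-1 * v^-1.
(** The subgroup [A<v>], with an integer exponent written as a difference of two natural ones. *)
Definition by_cyclic x := exists i j, A (x * v ^+ i * v ^- j).

Lemma twistedE a : a * v * a^-1 * v^-1 = a * (a^-1) ^ v^-1.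
Proof. by rewrite /conjg invgK !mulgA. Qed.

(** On the abelian group [A] the map sending [a] to [a * (a^-1) ^ v^-1] is an endomorphism, and
    [twisted] is its image. *)
Lemma subgroup_twisted : subgroup twisted.
Proof.
case: (sA) => A1 AM AV; split=> [|_ _ [a Aa ->] [b Ab ->]|_ [a Aa ->]].
- by exists 1; rewrite // invg1 mulg1 mul1g mulgV.
- exists (a * b); first exact: AM.
  rewrite !twistedE invgM conjMg; set a' := (a^-1) ^ _; set b' := (b^-1) ^ _.
  have -> : a * a' * (b * b') = a * (a' * (b * b')) by rewrite !mulgA.
  have -> : a' * (b * b') = b * b' * a' by apply: cA; rewrite /a' /b'; auto.
  by rewrite !mulgA.
- exists a^-1; first exact: AV.
  rewrite !twistedE invgM invgK -conjVg invgK.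
  by apply: cA; [exact: nA | exact: AV].
Qed.

Lemma twisted_conj w x : commute v w -> twisted x -> twisted (x ^ w).
Proof.
move=> cvw [a Aa ->]; exists (a ^ w); first exact: nA.
have vw : v ^ w = v by apply/conjg_fixP/commgP.
by rewrite !conjMg !conjVg vw.
Qed.

(** Says that [w] acts trivially on the quotient of [A] by [twisted], which is the group of
    coinvariants of [v]. *)
Definition fixes_mod_twisted w := forall c, A c -> twisted (c^-1 * c ^ w).

Lemma fixes_mod_twistedM w w' : commute v w' ->
  fixes_mod_twisted w -> fixes_mod_twisted w' -> fixes_mod_twisted (w * w').
Proof.
move=> cw' fw fw' c Ac; have [_ KM _] := subgroup_twisted.
have -> : c^-1 * c ^ (w * w') = (c^-1 * c ^ w') * (c^-1 * c ^ w) ^ w'.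
  rewrite conjMg conjVg -conjgM; move: (c ^ w') (c ^ (w * w')) => d d'.
  by rewrite !mulgA mulgK.
by apply: KM; [exact: fw' | apply: twisted_conj => //; exact: fw].
Qed.

Lemma fixes_mod_twistedV w : commute v w ->
  fixes_mod_twisted w -> fixes_mod_twisted w^-1.
Proof.
move=> cw fw c Ac; have [_ _ KV] := subgroup_twisted.
have -> : c^-1 * c ^ w^-1 = ((c ^ w^-1)^-1 * (c ^ w^-1) ^ w)^-1.
  by rewrite conjgKV invgM invgK.
by apply: KV; apply: fw; exact: nA.
Qed.

Lemma fixes_mod_twisted_power i j : fixes_mod_twisted (v ^+ i * v ^- j).
Proof.
have [K1 _ KV] := subgroup_twisted; case: (sA) => A1 AM AV.
have fV : fixes_mod_twisted v^-1.
  move=> c Ac; exists c^-1; first exact: AV.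
  by rewrite twistedE invgK.
have fv : fixes_mod_twisted v.
  by rewrite -[v]invgK; apply: fixes_mod_twistedV => //; exact: commuteV.
have fX k : fixes_mod_twisted (v ^+ k).
  elim: k => [|k IHk]; first by move=> c _; rewrite conjg1 mulVg.
  by rewrite expgSr; apply: fixes_mod_twistedM.
apply: fixes_mod_twistedM => //; first by apply/commuteV/commuteX.
by apply: fixes_mod_twistedV => //; exact: commuteX.
Qed.

Lemma commutators_by_cyclic x : commutators by_cyclic x -> twisted x.
Proof.
have [K1 KM KV] := subgroup_twisted; case: (sA) => A1 AM AV.
apply: commutators_min; first exact: subgroup_twisted.
move=> s t [i [j As]] [k [l At]].
pose w := v ^+ j * v ^- i; pose w' := v ^+ l * v ^- k.
have cv y p q : commute y v -> commute y (v ^+ p * v ^- q).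
  by move=> cyv; apply: commuteM; [apply: commuteX | apply/commuteV/commuteX].
have cww' : commute w w'.
  by apply/commute_sym/cv/commute_sym/cv.
have -> : s = s * v ^+ i * v ^- j * w by rewrite /w !mulgA mulgVK mulgK.
have -> : t = t * v ^+ k * v ^- l * w' by rewrite /w' !mulgA mulgVK mulgK.
move: (_ * v ^- j) (_ * v ^- l) As At => b b' Ab Ab'.
(* As [w] and [w'] commute and [A] is abelian, the commutator only records how [w'] moves [b] and
   how [w] moves [b' ^ w']. Both are powers of [v], so both displacements are twisted. *)
have -> : [~ b * w, b' * w'] =
    (b^-1 * b ^ w') ^ w * ((b' ^ w')^-1 * (b' ^ w') ^ w)^-1.
  have bb : b'^-1 * b = b * b'^-1 by apply: cA => //; exact: AV.
  have ww : w' * w * w'^-1 = w by rewrite -cww' mulgK.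
  transitivity (w^-1 * b^-1 * w'^-1 * (b * b'^-1) * (w' * w * w'^-1) * b' * w').
    by rewrite -bb ww /commg /conjg !invgM !mulgA.
  by rewrite /conjg !invgM !invgK !mulgA !(mulgK, mulgVK).
apply: KM; first by apply: twisted_conj; [exact: cv |]; exact: fixes_mod_twisted_power.
by apply: KV; apply: fixes_mod_twisted_power; exact: nA.
Qed.

End AbelianByCyclic.

(** * Edge paths and their flows *)

Section Edges.
Variable n : nat.
Implicit Types (u v w : word n).

Fixpoint prefixes w : seq (word n) :=
  if w is a :: w' then [::] :: map (cons a) (prefixes w') else [:: [::]].

(* The edges of the path labelled by [w]: the edge [(b, (i, p))], traversed backwards
   if [b], goes from the vertex [p] to [p X_i]. *)
Fixpoint edges w : seq (bool * ('I_n * word n)) :=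
  if w is a :: w' then
    (a.2, (a.1, if a.2 then [:: a] else [::])) ::
    map (fun e => (e.1, (e.2.1, a :: e.2.2))) (edges w')
  else [::].

Lemma nil_prefix w : [::] \in prefixes w.
Proof. by case: w => [|a w]; rewrite inE eqxx. Qed.

Lemma edges_prefix w e : e \in edges w -> e.2.2 \in prefixes w.
Proof.
elim: w e => //= -[i b] w IHw e; rewrite !inE => /orP[/eqP -> /=|].
  by case: b => //; rewrite (map_f (cons _)) ?orbT // nil_prefix.
by case/mapP=> f /IHw fp ->; rewrite /= (map_f (cons _)) ?orbT.
Qed.

End Edges.

Section Flow.
Variables (n : nat) (F : groupType) (X : 'I_n -> F).
Hypothesis X_free : free_basis X.
Hypothesis X_gen : forall x, exists w, x = word_value X w.
Variable S : F -> Prop.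
Hypothesis sS : subgroup S.
Local Notation val := (word_value X).

Let S1 : S 1. Proof. by case: sS. Qed.
Let SM x y : S x -> S y -> S (x * y). Proof. by case: sS => _ + _; apply. Qed.
Let SV x : S x -> S x^-1. Proof. by case: sS => _ _; apply. Qed.
Let SVK x : S x^-1 -> S x. Proof. by move/SV; rewrite invgK. Qed.

(* The chosen representative of the coset [S g]; that of [S] is [1], so that
   [schreier_rewriting] expresses the words with value in [S]. *)
Definition rep (g : F) : F :=
  if `[< S g >] then 1 else choose (fun x => `[< S (x / g) >]) g.

Lemma rep1 g : S g -> rep g = 1.
Proof. by rewrite /rep => /asboolT ->. Qed.

Lemma rep_mem g : S (rep g / g).
Proof.
rewrite /rep; case: asboolP => Sg; first by rewrite mul1g; exact: SV.
by apply/asboolP; apply: (@chooseP _ (fun x => `[< S (x / g) >])); rewrite mulgV; apply/asboolP.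
Qed.

Lemma rep_eq g h : S (g / h) -> rep g = rep h.
Proof.
move=> gh; rewrite /rep.
have E x : `[< S (x / g) >] = `[< S (x / h) >].
  apply: asbool_equiv_eq; split=> xS.
    by have := SM xS gh; rewrite mulgA mulgVK.
  by have := SM xS (SV gh); rewrite invgM invgK mulgA mulgVK.
have -> : `[< S g >] = `[< S h >].
  apply: asbool_equiv_eq; split=> Sx.
    by have := SM (SV gh) Sx; rewrite invgM invgK mulgVK.
  by have := SM gh Sx; rewrite mulgVK.
case: ifP => // _; rewrite (eq_choose E); apply: choose_id; apply/asboolP => //.
by rewrite mulgV.
Qed.

Lemma rep_inj g h : rep g = rep h -> S (g / h).
Proof.
move=> gh; have := SM (SV (rep_mem g)) (rep_mem h).
by rewrite gh invgM invgK mulgA mulgVK.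
Qed.

Lemma rep_mulr g h y : rep g = rep h -> rep (g * y) = rep (h * y).
Proof. by move/rep_inj => gh; apply: rep_eq; rewrite invgM mulgA mulgK. Qed.

Lemma rep_rep g y : rep (rep g * y) = rep (g * y).
Proof. by apply: rep_eq; rewrite invgM mulgA mulgK; exact: rep_mem. Qed.

(* The edges, in the Schreier graph of [S], of the path labelled by [w] from the
   coset of [g]. *)
Definition coset_edge (g : F) (e : bool * ('I_n * word n)) : bool * (F * 'I_n) :=
  (e.1, (rep (g * val e.2.2), e.2.1)).
Definition coset_edges g w := map (coset_edge g) (edges w).

Lemma coset_edges_cons g a w : coset_edges g (a :: w) =
  (a.2, (rep (if a.2 then g / X a.1 else g), a.1)) ::
  coset_edges (g * (if a.2 then (X a.1)^-1 else X a.1)) w.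
Proof.
rewrite /coset_edges /= /coset_edge /= -map_comp; congr (_ :: _).
  by case: a => i [] /=; rewrite ?word_value_cons ?word_value_nil ?mulg1.
by apply: eq_map => e /=; rewrite word_value_cons mulgA.
Qed.

Lemma coset_edges_eq g h w : rep g = rep h -> coset_edges g w = coset_edges h w.
Proof. by move=> gh; apply: eq_map => e; rewrite /coset_edge (rep_mulr _ gh). Qed.

Definition balanced w := forall e, count_mem (true, e) (coset_edges 1 w) =
  count_mem (false, e) (coset_edges 1 w).

Definition schreier_gen (e : F * 'I_n) : F := e.1 * X e.2 / rep (e.1 * X e.2).

Lemma schreier_gen_mem e : S (schreier_gen e).
Proof. by apply: SVK; rewrite invgM invgK; exact: rep_mem. Qed.

(** Reidemeister-Schreier rewriting: each letter contributes the Schreier generator of its edge or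
    the inverse, and the representatives of the intermediate cosets cancel. *)
Lemma schreier_rewriting g w : rep g * val w =
  (\prod_(a <- coset_edges g w) letter_value schreier_gen a) * rep (g * val w).
Proof.
elim: w g => [|[i b] w IHw] g.
  by rewrite big_nil word_value_nil mul1g !mulg1.
rewrite coset_edges_cons big_cons word_value_cons /=.
set x := if b then _ else _; rewrite -[RHS]mulgA [g * (x * _)]mulgA -IHw !mulgA.
congr (_ * _); rewrite /letter_value /schreier_gen {}/x /=.
case: b => /=; rewrite rep_rep; last by rewrite mulgVK.
by rewrite mulgVK !invgM !invgK !mulgA mulgVK.
Qed.

Lemma balanced_commutator w : S (val w) -> balanced w -> commutators S (val w).
Proof.
move=> Sw bal; have := schreier_rewriting 1 w.
rewrite mul1g !rep1 // mul1g mulg1 => ->.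
by apply: balanced_commutators => //; exact: schreier_gen_mem.
Qed.

Lemma coset_edges_cat g u w :
  coset_edges g (u ++ w) = coset_edges g u ++ coset_edges (g * val u) w.
Proof.
elim: u g => [|a u IHu] g; first by rewrite word_value_nil mulg1.
by rewrite cat_cons !coset_edges_cons IHu word_value_cons mulgA.
Qed.

Section Crossing.
Local Open Scope ring_scope.
Variable e : F * 'I_n.

Definition crosses (g : F) (i : 'I_n) : int := ((rep g, i) == e)%:Z.

(** The second component counts the signed crossings of the edge [e]. Freeness of [X] extends these
    bijections to an action of [F]; this is why the flow of a word depends only on its value, with
    no recourse to reduced words. *)
Definition cross_fun i (s : F * int) : F * int := (s.1 * X i, s.2 + crosses s.1 i)%g.
Definition cross_inv i (s : F * int) : F * int :=
  (s.1 / X i, s.2 - crosses (s.1 / X i)%g i)%g.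

Lemma cross_funK i : cancel (cross_fun i) (cross_inv i).
Proof. by move=> [g k]; rewrite /cross_fun /cross_inv /= mulgK; congr (_, _); lia. Qed.
Lemma cross_invK i : cancel (cross_inv i) (cross_fun i).
Proof. by move=> [g k]; rewrite /cross_fun /cross_inv /= mulgVK; congr (_, _); lia. Qed.

Definition flow g w : int :=
  (count_mem (false, e) (coset_edges g w))%:Z - (count_mem (true, e) (coset_edges g w))%:Z.

Lemma cross_word g k w :
  word_value (fun i => Bijection (cross_funK i) (cross_invK i)) w (g, k) =
  (g * val w, k + flow g w)%g.
Proof.
elim: w g k => [|[i b] w IHw] g k.
  by rewrite !word_value_nil /flow /= mulg1; congr (_, _); lia.
rewrite !word_value_cons mulgA /= /flow coset_edges_cons /=.
case: b => /=; rewrite IHw /flow /crosses !xpair_eqE /=; congr (_, _);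
  by case: (_ == e) => /=; lia.
Qed.

Lemma flow_val g w w' : val w = val w' -> flow g w = flow g w'.
Proof.
move=> ww'; have [phi phiX _] := X_free
  (fun i => Bijection (cross_funK i) (cross_invK i)).
have phiE u : phi (val u) = word_value (fun i => Bijection (cross_funK i) (cross_invK i)) u.
  by rewrite word_value_morph; congr word_value; apply: funext.
have := cross_word g 0 w'; rewrite -phiE -ww' phiE cross_word => -[].
by rewrite !GRing.add0r.
Qed.

Definition gflow g x := flow g (sval (cid (X_gen x))).

Lemma gflow_val g w : gflow g (val w) = flow g w.
Proof. by apply: flow_val; case: cid. Qed.

Lemma gflowM g x y : gflow g (x * y)%g = gflow g x + gflow (g * x)%g y.
Proof.
have [[u ->] [w ->]] := (X_gen x, X_gen y).
rewrite -word_value_cat !gflow_val /flow coset_edges_cat !count_cat; lia.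
Qed.

Lemma gflow1 g : gflow g 1%g = 0.
Proof. by have := gflowM g 1%g 1%g; rewrite !mulg1; lia. Qed.

Lemma gflow_eq g h x : rep g = rep h -> gflow g x = gflow h x.
Proof. by move=> gh; rewrite /gflow /flow (coset_edges_eq _ gh). Qed.

Lemma gflow_mem g x : S g -> gflow g x = gflow 1%g x.
Proof. by move=> Sg; apply: gflow_eq; rewrite !rep1. Qed.

(** By the cocycle rule [gflowM], the flow from the base point is a homomorphism from [S] to the
    integers, so it vanishes on commutators. *)
Lemma gflow_commutators x : commutators S x -> gflow 1%g x = 0.
Proof.
move=> xS; suff [] : S x /\ gflow 1%g x = 0 by [].
move: x xS.
have fM x y : S x -> gflow 1%g (x * y)%g = gflow 1%g x + gflow 1%g y.
  by move=> Sx; rewrite gflowM mul1g [in X in _ + X]gflow_mem.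
have fV x : S x -> gflow 1%g x^-1%g = - gflow 1%g x.
  by move=> Sx; have := fM x x^-1%g Sx; rewrite mulgV gflow1; lia.
apply: (commutators_min (H := fun x => S x /\ gflow 1%g x = 0)).
  split; first by split; rewrite ?gflow1.
    by move=> x y [Sx x0] [Sy y0]; rewrite fM // x0 y0; split; [exact: SM|lia].
  by move=> x [Sx x0]; rewrite fV // x0; split; [exact: SV|lia].
move=> a b Sa Sb; rewrite /commg /conjg.
have [SaV SbV] := (SV Sa, SV Sb); have Sab := SM Sa Sb; have Sbab := SM SbV Sab.
by split; [exact: SM|rewrite !fM // !fV //; lia].
Qed.

(** This makes the search for a conjugator finite: an edge that carries flow starts at the coset of
    one of finitely many prefixes. *)
Lemma flow_neq0 g w : flow g w != 0 ->
  exists2 p, p \in prefixes w & e.1 = rep (g * val p)%g.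
Proof.
rewrite /flow => fn0; have [b] : exists b, (b, e) \in coset_edges g w.
  case E: (count_mem (false, e) (coset_edges g w)) fn0 => [|k] fn0.
    exists true; rewrite -has_pred1 has_count; case: count fn0 => //.
  by exists false; rewrite -has_pred1 has_count E.
by case/mapP=> f /edges_prefix fp [_ ->]; exists f.2.2.
Qed.

End Crossing.
Lemma balancedP w : (forall e, gflow e 1 (val w) = 0%R) <-> balanced w.
Proof.
split=> [f0|bal] e; last by rewrite gflow_val /flow bal GRing.subrr.
by have /eqP := f0 e; rewrite gflow_val /flow GRing.subr_eq0 => /eqP[].
Qed.

Lemma commutator_balanced w : commutators S (val w) -> balanced w.
Proof. by move=> wS; apply/balancedP => e; exact: gflow_commutators. Qed.

End Flow.

Section ByCyclic.
Variables (G : groupType) (A : G -> Prop) (v : G).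
Hypotheses (sA : subgroup A) (nA : forall x y, A x -> A (x ^ y)).

Lemma power_quotM i j k l : v ^+ i * v ^- j * (v ^+ k * v ^- l) =
  v ^+ (i + k) * v ^- (j + l).
Proof.
rewrite expgnDr addnC expgnDr invgM !mulgA; congr (_ * _).
rewrite -!mulgA; congr (_ * _).
by apply/commute_sym/commuteV/commuteX2.
Qed.

Lemma subgroup_by_cyclic : subgroup (by_cyclic A v).
Proof.
have [A1 AM AV] := sA; split.
- by exists 0, 0; rewrite expg0 invg1 !mulg1.
- move=> x y [i [j xA]] [k [l yA]]; exists (k + i), (l + j).
  rewrite -mulgA -power_quotM; move: xA yA; rewrite -2!(mulgA _ (v ^+ _)).
  move: (v ^+ i * _) (v ^+ k * _) => w w' xA yA.
  have -> : x * y * (w' * w) = x * w * (y * w') ^ w.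
    by rewrite /conjg !mulgA mulgK.
  by apply: AM => //; exact: nA.
- move=> x [i [j xA]]; exists j, i; move: xA; rewrite -2!(mulgA _ (v ^+ _)) => xA.
  have -> : x^-1 * (v ^+ j * v ^- i) = ((x * (v ^+ i * v ^- j))^-1) ^ x.
    by rewrite /conjg !invgM !invgK !mulgA mulgVK.
  by apply/nA/AV.
Qed.

Lemma by_cyclic_in x : A x -> by_cyclic A v x.
Proof. by exists 0, 0; rewrite expg0 invg1 !mulg1. Qed.

Lemma by_cyclic_gen : by_cyclic A v v.
Proof. by have [A1 _ _] := sA; exists 0, 1%N; rewrite expg0 mulg1 expg1 mulgV. Qed.

End ByCyclic.

Section QuotientMap.
Variables (G : groupType) (N : normalSubgroup G).
Local Notation q := (quotient_map N).

Lemma quotient_mapM x y : q (x * y) = q x * q y.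
Proof. exact: pi_quotient_mul. Qed.

Lemma quotient_mapV x : q x^-1 = (q x)^-1.
Proof. exact: pi_quotient_inv. Qed.

Lemma quotient_mapP x y : reflect (q x = q y) (x^-1 * y \in N).
Proof. by rewrite -quotient_eqE; exact: (iffP eqP). Qed.

Lemma quotient_map_eq1 x : reflect (q x = 1) (x \in N).
Proof. by rewrite -gpredV -[x^-1]mulg1; apply: quotient_mapP. Qed.

Lemma quotient_mapX x k : q (x ^+ k) = q x ^+ k.
Proof. by elim: k => [|k IHk] //; rewrite !expgS quotient_mapM IHk. Qed.

Lemma quotient_map_surj (y : quotient_group N) : exists x, y = q x.
Proof. by exists (repr y); rewrite /quotient_map reprK. Qed.

Lemma word_value_quotient n (X : 'I_n -> G) w :
  word_value (fun i => q (X i)) w = q (word_value X w).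
Proof.
elim: w => [|[i b] w IHw]; first by rewrite !word_value_nil.
by rewrite !word_value_cons IHw quotient_mapM; case: b; rewrite //= quotient_mapV.
Qed.

Lemma subgroup_normal : subgroup (fun x => x \in N).
Proof. by split=> [|x y|x]; [exact: gpred1 | exact: gpredM | rewrite gpredV]. Qed.

(** The image of [N<v>] in the quotient by [N] is cyclic, hence abelian. *)
Lemma commutators_by_cyclic_normal v x :
  commutators (by_cyclic (fun y => y \in N) v) x -> x \in N.
Proof.
apply: (commutators_min (H := fun x => x \in N)); first exact: subgroup_normal.
have qE s : by_cyclic (fun y => y \in N) v s -> exists i j, q s = q v ^+ i * q v ^- j.
  move=> [i [j /quotient_map_eq1]]; rewrite !quotient_mapM quotient_mapV !quotient_mapX.
  by move=> sE; exists j, i; apply: (mulIg (q v ^+ i * q v ^- j)); rewrite mulgA sE !mulgA mulgVK mulgV.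
move=> a b /qE[i [j aE]] /qE[k [l bE]]; apply/quotient_map_eq1.
rewrite /commg /conjg !quotient_mapM !quotient_mapV aE bE.
by rewrite power_quotM addnC (addnC j) -power_quotM mulKg mulVg.
Qed.

End QuotientMap.

(** * Conjugacy in F/N' *)

Section Criterion.
Variables (n : nat) (F : groupType) (X : 'I_n -> F) (N : normalSubgroup F).
Hypothesis X_free : free_basis X.
Hypothesis X_gen : forall x, exists w, x = word_value X w.
Local Notation val := (word_value X).
Local Notation q := (quotient_map (derived N : normalSubgroup F)).
Local Notation S v := (by_cyclic (fun x => x \in N) v).

Let nN x y : x \in N -> x ^ y \in N. Proof. exact: gpredJ_all. Qed.

Lemma by_cyclic_subgroup v : subgroup (S v).
Proof. by apply: subgroup_by_cyclic; [exact: subgroup_normal | exact: nN]. Qed.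

Lemma conjugate_commutator (u v h : F) : commutators (S v) (h * u * h^-1 * v^-1) ->
  conjugate (q u) (q v).
Proof.
pose A (y : quotient_group (derived N : normalSubgroup F)) := exists2 m, m \in N & y = q m.
have [N1 NM NV] := subgroup_normal N.
have sA : subgroup A.
  split; first by exists 1.
    by move=> _ _ [x xN ->] [y yN ->]; exists (x * y); rewrite ?quotient_mapM //; exact: NM.
  by move=> _ [x xN ->]; exists x^-1; rewrite ?quotient_mapV //; exact: NV.
have nA x y : A x -> A (x ^ y).
  move=> [m mN ->]; have [z ->] := quotient_map_surj y; exists (m ^ z); first exact: nN.
  by rewrite /conjg !quotient_mapM quotient_mapV.
have cA x y : A x -> A y -> commute x y.
  move=> [m mN ->] [k kN ->]; rewrite /commute -!quotient_mapM; apply/quotient_mapP.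
  apply/derivedP; have -> : (m * k)^-1 * (k * m) = [~ k, m].
    by rewrite /commg /conjg invgM !mulgA.
  exact: commutators_in.
move=> xS; have : twisted A (q v) (q (h * u * h^-1 * v^-1)).
  apply: commutators_by_cyclic => // H sH HS.
  have [H1 HM HV] := sH.
  apply: (xS (fun x => H (q x))).
    split=> // [x y|x]; first by rewrite quotient_mapM; exact: HM.
    by rewrite quotient_mapV; exact: HV.
  have SA x : S v x -> by_cyclic A (q v) (q x).
    move=> [i [j xN]]; exists i, j; exists (x * v ^+ i * v ^- j) => //.
    by rewrite !quotient_mapM quotient_mapV !quotient_mapX.
  move=> a b /SA aA /SA bA; rewrite /commg /conjg !quotient_mapM !quotient_mapV.
  exact: HS.
(* Cancelling [v^-1] leaves [h u h^-1 = m v m^-1] modulo [N'], so [h^-1 m] conjugates [u] to [v]. *)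
move=> [_ [m mN ->]]; rewrite 3!quotient_mapM 2!quotient_mapV => /(mulIg _) E.
exists ((q h)^-1 * q m); rewrite conjgM [q u ^ _]conjgE invgK mulgA E.
by rewrite /conjg !mulgA mulVg mul1g mulgVK.
Qed.

Definition conjugator_check u v (p r : word n) :=
  let w := (p ++ word_inv r) ++ u ++ word_inv (p ++ word_inv r) ++ word_inv v in
  val w \in N /\ balanced X (S (val v)) w.

Lemma val_check u v p r :
  val ((p ++ word_inv r) ++ u ++ word_inv (p ++ word_inv r) ++ word_inv v) =
  val p / val r * val u * (val p / val r)^-1 * (val v)^-1.
Proof. by rewrite !word_value_cat !word_value_inv !word_value_cat !word_value_inv !mulgA. Qed.

Lemma conjugate_quotient_derived u v :
  conjugate (word_value (fun i => q (X i)) u) (word_value (fun i => q (X i)) v) <->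
  exists p r, [/\ p \in prefixes v, r \in prefixes u & conjugator_check u v p r].
Proof.
rewrite !word_value_quotient; set U := val u; set V := val v.
have sS := by_cyclic_subgroup V.
pose flow := gflow X_gen (S V).
have [S1 SM SV] := sS.
have NS x : x \in N -> S V x by exact: by_cyclic_in.
have SV1 : S V V by apply: by_cyclic_gen; exact: subgroup_normal.
split=> [[g]|[p [r [_ _ [wN bal]]]]]; last first.
  apply: (@conjugate_commutator U V (val p / val r)); rewrite -val_check.
  by apply: balanced_commutator => //; exact: NS.
have [h0 ->] := quotient_map_surj g; rewrite /conjg -quotient_mapV -!quotient_mapM.
move=> /quotient_mapP; rewrite -{2}[h0]invgK; move: (h0^-1) => {h0} {}g.
move=> xD; have {}xD : g * U * g^-1 * V^-1 \in derived N.
  have -> : g * U * g^-1 * V^-1 = (V^-1 * (g * (U * g^-1))) ^ V^-1.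
    by rewrite conjgE invgK !mulgA mulgV mul1g.
  exact: gpredJ_all.
move/derivedP: (xD) => /(commutators_mono NS).
set x := g * U * g^-1 * V^-1 => xS.
have Sx := commutators_sub sS xS.
have xE : g * U * g^-1 = x * V by rewrite /x mulgVK.
(* The path [g U g^-1] ends in the coset where it starts, so the flows of its outer parts [g] and
   [g^-1] cancel; and [x], being in [[S, S]], adds no flow to [V]. *)
have fgU e : flow e g U = flow e 1 V.
  have fM y z z' : flow e y (z * z') = (flow e y z + flow e (y * z)%g z')%R.
    exact: gflowM.
  have f1 y : flow e y 1 = 0%R by exact: gflow1.
  have fS y z : S V y -> flow e y z = flow e 1 z by move=> ?; exact: gflow_mem.
  have E1 : flow e 1 (g * U * g^-1) = flow e 1 V.
    rewrite xE fM mul1g (fS x V Sx).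
    by rewrite /flow (gflow_commutators X_free X_gen sS e xS); lia.
  have SxV : S V (g * U * g^-1) by rewrite xE; exact: SM.
  have E2 := fM (g * U) g^-1 g; rewrite mulVg f1 (fS _ g SxV) in E2.
  have E3 := fM 1 (g * U) g^-1; have E4 := fM 1 g U; rewrite !mul1g in E3 E4.
  move: E1 E2; rewrite E3 E4; move: (flow e 1 g) (flow e g U) (flow e (g * U) g^-1).
  by move=> a b c <-; lia.
have check_ok p r h : commutators (S V) (h * U * h^-1 * V^-1) ->
    val p / val r = h -> conjugator_check u v p r.
  move=> D hE; rewrite /conjugator_check val_check hE -/U -/V.
  split; first exact: commutators_by_cyclic_normal D.
  by apply: (commutator_balanced X_free X_gen); rewrite // val_check hE.
(* Without flow, [V] lies in [[S, S]] and so in [N]. Then [S] is [N], both [U] and [V] lie in [N'],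
   and the empty prefixes suffice. *)
have [V0|/existsNP[e /eqP eV]] := pselect (forall e, flow e 1 V = 0%R).
  have VD : commutators (S V) V.
    by apply: balanced_commutator => //; apply/(balancedP X_free X_gen).
  have VN := commutators_by_cyclic_normal VD.
  have SN y : S V y -> y \in N.
    by move=> [i [j]]; rewrite -mulgA gpredMr // gpredM ?gpredXn // gpredV gpredXn.
  exists [::], [::]; split; rewrite ?nil_prefix //.
  apply: (check_ok _ _ 1); last by rewrite word_value_nil divg1.
  apply: (commutators_mono NS); apply/derivedP.
  have {}VD : V \in derived N by apply/derivedP; exact: commutators_mono VD.
  rewrite invg1 mulg1 mul1g gpredM ?gpredV //.
  have -> : U = (x * V) ^ g by rewrite -xE /conjg !mulgA mulVg mul1g mulgVK.
  by apply: gpredJ_all; rewrite gpredM.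
(* An edge with flow starts at the coset of a prefix [p] of [v] and also at that of [g r] for a
   prefix [r] of [u]. Hence [p r^-1] is [s g] for some [s] in [S]. *)
have [p pv pE] : exists2 p, p \in prefixes v & e.1 = rep (S V) (1 * val p).
  by apply: flow_neq0; rewrite -(gflow_val X_free X_gen).
have [r ru rE] : exists2 r, r \in prefixes u & e.1 = rep (S V) (g * val r).
  by apply: flow_neq0; rewrite -(gflow_val X_free X_gen) -/(flow e g U) fgU.
exists p, r; split=> //; have Ss : S V (val p / val r / g).
  rewrite -mulgA -invgM; apply: rep_inj => //.
  by rewrite -rE pE mul1g.
apply: (check_ok _ _ (val p / val r)) => //.
rewrite -[val p / val r](mulgVK g); move: (_ / g) Ss => s Ss.
have [D1 DM DV] := subgroup_commutators (S V).
(* Replacing [g] by [s g] changes [x] only by a conjugation by [s] and a commutator of elements of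
   [S]. *)
have -> : s * g * U * (s * g)^-1 * V^-1 = s * x * s^-1 * [~ s^-1, V^-1].
  by rewrite /commg /conjg /x !invgM !invgK !mulgA !(mulgVK, mulgK).
apply: DM; first exact: commutators_conj.
by apply: commutators_in; exact: SV.
Qed.

End Criterion.

(** * The decision procedure for conjugacy in F/N' *)

Lemma recursive_wordsP n (P : word n.+1 -> Prop) :
  computable (fun g : word n.+1 * unit => `[< P g.1 >]) -> recursive_words P.
Proof.
(* In this context the variable is read through [word_code], as [recursive_words] demands, instead
   of the list encoding. *)
move=> PP; pose cw := context_cons (eA := @word_code n.+1) (cC := context_nil).
have [f Pf] : @computable _ cw _ _ (fun g => `[< P g.1 >]).
  apply: (comp_subst (S := fun g => (g.1, tt)) PP).
  apply: subst_cons; last exact: subst_nil.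
  by apply: comp_word_decode; apply: (@comp_code _ cw _ (@word_code n.+1)); comp.
exists f => w; have := Pf (w, tt); congr computes; exact: val_inj.
Qed.

Lemma recursive_words2P n (P : word n.+1 -> word n.+1 -> Prop) :
  computable (fun g : word n.+1 * (word n.+1 * unit) => `[< P g.1 g.2.1 >]) ->
  recursive_words2 P.
Proof.
move=> PP; pose c1 := context_cons (eA := @word_code n.+1) (cC := context_nil).
pose c2 := context_cons (eA := @word_code n.+1) (cC := c1).
have [f Pf] : @computable _ c2 _ _ (fun g => `[< P g.1 g.2.1 >]).
  apply: (comp_subst (S := fun g => (g.1, (g.2.1, tt))) PP).
  apply: subst_cons.
    by apply: comp_word_decode; apply: (@comp_code _ c2 _ (@word_code n.+1)); comp.
  apply: subst_cons; last exact: subst_nil.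
  apply: comp_word_decode; apply: (@comp_code _ c2 _ (@word_code n.+1)).
  exact: comp_var (@subst_snd _ c2 _ c1 _ (@word_code n.+1) _ subst_id).
exists f => u v; have := Pf (u, (v, tt)); congr computes; exact: val_inj.
Qed.

Lemma recursive_words2_comp C {cC : context C} n (P : word n.+1 -> word n.+1 -> Prop)
    (u v : C -> word n.+1) : recursive_words2 P ->
  computable u -> computable v -> computable (fun g => `[< P (u g) (v g) >]).
Proof.
move=> [f Pf] Pu Pv; pose c1 := context_cons (eA := @word_code n.+1) (cC := context_nil).
pose c2 := context_cons (eA := @word_code n.+1) (cC := c1).
have PP : @computable _ c2 _ _ (fun g => `[< P g.1 g.2.1 >]).
  exists f => -[x [y []]]; have := Pf x y; congr computes; exact: val_inj.
apply: (comp_subst (S := fun g => (u g, (v g, tt))) PP).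
apply: subst_cons; first exact: comp_encode (comp_word_code Pu).
apply: subst_cons; last exact: subst_nil.
exact: comp_encode (comp_word_code Pv).
Qed.

Section Decision.
Variable n : nat.
Local Notation word := (word n.+1).

Section WordPrograms.
Context {C : Type} {cC : context C}.

Lemma comp_word_inv (F : C -> word) : computable F ->
  computable (fun g => word_inv (F g)).
Proof. by move=> PF; rewrite /word_inv; comp. Qed.

Lemma comp_word_exp (F : C -> word) N : computable F -> computable N ->
  computable (fun g => word_exp (F g) (N g)).
Proof. by move=> PF PN; rewrite /word_exp; comp. Qed.

Lemma comp_prefixes (F : C -> word) : computable F ->
  computable (fun g => prefixes (F g)).
Proof.
move=> PF; refine (comp_ext (F := fun g =>
  foldr (fun a s => [::] :: map (fun w => a :: w) s) [:: [::]] (F g)) _ _).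
  by move=> g; elim: (F g) => //= a w ->.
comp.
Qed.

Lemma comp_edges (F : C -> word) : computable F ->
  computable (fun g => edges (F g)).
Proof.
move=> PF; refine (comp_ext (F := fun g =>
  foldr (fun a s => (a.2, (a.1, if a.2 then [:: a] else [::])) ::
    map (fun e => (e.1, (e.2.1, a :: e.2.2))) s) [::] (F g)) _ _).
  by move=> g; elim: (F g) => //= a w ->.
comp.
Qed.

End WordPrograms.

Ltac step_words := lazymatch goal with
  | |- computable (fun g => word_inv _) => refine (comp_word_inv _)
  | |- computable (fun g => word_exp _ _) => refine (comp_word_exp _ _)
  | |- computable (fun g => prefixes _) => refine (comp_prefixes _)
  | |- computable (fun g => edges _) => refine (comp_edges _)
  | |- _ => step_coding
  end.
Ltac comp_step ::= step_words.

Variables (F : groupType) (X : 'I_n.+1 -> F) (N : normalSubgroup F).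
Hypothesis X_free : free_basis X.
Hypothesis X_gen : forall x, exists w, x = word_value X w.
Variable triv : word -> bool.
Hypothesis trivE : forall w, triv w = (word_value X w \in N).
Hypothesis comp_triv : computable (fun p : word * unit => triv p.1).
Local Notation val := (word_value X).
Local Notation S v := (by_cyclic (fun x => x \in N) v).
Hypothesis power_bound : forall v w, S (val v) (val w) -> exists k,
  k < size w + 5 /\ (val w * val v ^+ k \in N \/ val w * val v ^- k \in N).

Definition in_by_cyclic v w : bool :=
  has (fun k => triv (w ++ word_exp v k) || triv (w ++ word_exp (word_inv v) k))
    (iota 0 (size w + 5)).

Lemma in_by_cyclicP v w : reflect (S (val v) (val w)) (in_by_cyclic v w).
Proof.
apply: (iffP hasP) => [[k _]|/power_bound[k [ltk kN]]].
  rewrite !trivE !word_value_cat !word_value_exp word_value_inv expVgn => /orP[]kN.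
    by exists k, 0; rewrite expg0 invg1 mulg1.
  by exists 0, k; rewrite expg0 mulg1.
exists k; first by rewrite mem_iota.
rewrite !trivE !word_value_cat !word_value_exp word_value_inv expVgn.
by case: kN => ->; rewrite ?orbT.
Qed.

Definition same_edge v (e e' : bool * ('I_n.+1 * word)) : bool :=
  (e.2.1 == e'.2.1) && in_by_cyclic v (e.2.2 ++ word_inv e'.2.2).

Definition balancedb v w : bool :=
  all (fun e => count (fun e' => e'.1 && same_edge v e e') (edges w) ==
                count (fun e' => ~~ e'.1 && same_edge v e e') (edges w)) (edges w).

(** Cosets are compared, never computed: equally labelled edges starting at [p] and [p'] coincide
    iff [p p'^-1] is in [N<v>]. Edges off the path have both counts zero, so testing the edges of
    [w] is enough. *)
Lemma balancedbP v w : reflect (balanced X (S (val v)) w) (balancedb v w).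
Proof.
have sS := by_cyclic_subgroup N (val v).
have sameE b e : count_mem (b, (coset_edge X (S (val v)) 1 e).2)
      (coset_edges X (S (val v)) 1 w) =
    count (fun e' => (e'.1 == b) && same_edge v e e') (edges w).
  rewrite count_map; apply: eq_count => e' /=.
  rewrite /coset_edge !xpair_eqE /= /same_edge [e.2.1 == _]eq_sym; congr (_ && _).
  rewrite andbC; congr (_ && _); rewrite !mul1g.
  apply: (sameP eqP); apply: (iffP (in_by_cyclicP _ _)).
    by rewrite word_value_cat word_value_inv => /(rep_eq sS) ->.
  by rewrite word_value_cat word_value_inv => /esym/(rep_inj sS).
have trueE (b c : bool) : (b == true) && c = b && c by case: b.
have falseE (b c : bool) : (b == false) && c = ~~ b && c by case: b.
apply: (iffP allP) => [bal f|bal e ew].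
  have [[e ew fE]|nf] := pselect (exists2 e, e \in edges w & f = (coset_edge X (S (val v)) 1 e).2).
    rewrite fE !sameE; under eq_count do rewrite trueE.
    by under [in RHS]eq_count do rewrite falseE; apply/eqP/bal.
  have count0 b : count_mem (b, f) (coset_edges X (S (val v)) 1 w) = 0.
    apply/count_memPn/mapP => -[e ew eE]; apply: nf; exists e => //.
    by rewrite -eE.
  by rewrite !count0.
have := bal (coset_edge X (S (val v)) 1 e).2; rewrite !sameE.
under eq_count do rewrite trueE.
by under [in RHS]eq_count do rewrite falseE; move/eqP.
Qed.

Definition conjugate_dec (u v : word) : bool :=
  has (fun p => has (fun r =>
    triv ((p ++ word_inv r) ++ u ++ word_inv (p ++ word_inv r) ++ word_inv v) &&
    balancedb v ((p ++ word_inv r) ++ u ++ word_inv (p ++ word_inv r) ++ word_inv v))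
    (prefixes u)) (prefixes v).

Lemma comp_triv_app C {cC : context C} (G : C -> word) : computable G ->
  computable (fun g => triv (G g)).
Proof. exact: comp_app1 comp_triv. Qed.

Ltac step_triv := lazymatch goal with
  | |- computable (fun g => triv _) => refine (comp_triv_app _)
  | |- _ => step_words
  end.
Ltac comp_step ::= step_triv.

Lemma comp_conjugate_dec :
  computable (fun g : word * (word * unit) => conjugate_dec g.1 g.2.1).
Proof.
rewrite /conjugate_dec /balancedb /same_edge /in_by_cyclic; comp.
Qed.

Lemma conjugacy_problem_derived_decidable :
  conjugacy_problem_decidable
    (fun i => quotient_map (derived N : normalSubgroup F) (X i)).
Proof.
apply: recursive_words2P; apply: comp_ext comp_conjugate_dec => -[u [v []]] /=.
apply/esym/asbool_equiv_eqP; last exact: (conjugate_quotient_derived N X_free X_gen u v).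
apply: (iffP hasP) => [[p pv /hasP[r ru /andP[wN bal]]]|[p [r [pv ru [wN bal]]]]].
  by exists p, r; split=> //; split; [rewrite -trivE | apply/balancedbP].
exists p => //; apply/hasP; exists r => //; rewrite trivE wN.
exact/balancedbP.
Qed.

End Decision.

(** * The group F/N *)

Section TapeGroup.
Variable T : nat -> nat -> bool.
Hypothesis comp_T : computable (fun p : nat * (nat * unit) => T p.1 p.2.1).

(** A positive integer is [2^e (2 c + 1)] for a unique pair, which the head and tail of the list
    that it codes return. *)
Definition erased (d : int) : bool :=
  if d is Posz m then (0 < m)%N && T (code_head m) (code_tail m) else false.

Lemma erased_code e c : erased (Posz (2 ^ e * c.*2.+1)%N) = T e c.
Proof.
have -> : (2 ^ e * c.*2.+1)%N = CodeSeq.code (e :: CodeSeq.decode c).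
  by rewrite /= CodeSeq.decodeK.
by rewrite /erased code_gt0 code_headK code_tailK CodeSeq.decodeK.
Qed.

Definition state : Type := int * ((int -> bool) * (int -> bool)).

Section Moves.
Local Open Scope ring_scope.

Definition write_fun (s : state) : state :=
  (s.1, (fun d => s.2.1 d (+) (~~ erased d && s.2.2 (d + s.1)), s.2.2)).
Definition toggle_fun (s : state) : state :=
  (s.1, (s.2.1, fun d => s.2.2 d (+) (d == s.1))).
Definition right_fun (s : state) : state := (s.1 + 1, s.2).
Definition left_fun (s : state) : state := (s.1 - 1, s.2).

Fact write_funK : cancel write_fun write_fun.
Proof.
move=> [s [p q]]; rewrite /write_fun /=; congr (_, (_, _)).
by apply: funext => d; rewrite -addbA addbb addbF.
Qed.
Fact toggle_funK : cancel toggle_fun toggle_fun.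
Proof.
move=> [s [p q]]; rewrite /toggle_fun /=; congr (_, (_, _)).
by apply: funext => d; rewrite -addbA addbb addbF.
Qed.
Fact right_funK : cancel right_fun left_fun.
Proof. by move=> [s pq]; rewrite /left_fun /=; congr (_, _); lia. Qed.
Fact left_funK : cancel left_fun right_fun.
Proof. by move=> [s pq]; rewrite /right_fun /=; congr (_, _); lia. Qed.
End Moves.

Definition move (i : 'I_3) : bijection state :=
  match nat_of_ord i with
  | 0 => Bijection write_funK write_funK
  | 1 => Bijection toggle_funK toggle_funK
  | _ => Bijection right_funK left_funK
  end.

Local Notation run := (word_value move).
Local Notation F := (free_group 3).
Local Notation X := (@free_gen 3).

Definition tape_kernel : {pred F} := fun x => free_eval move x == 1.

Lemma tape_kernelP x : reflect (free_eval move x = 1) (x \in tape_kernel).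
Proof. exact: eqP. Qed.

Fact tape_kernelM : mulg_closed tape_kernel.
Proof.
move=> x y /tape_kernelP x1 /tape_kernelP y1; apply/tape_kernelP.
by rewrite free_eval_mul x1 y1 mulg1.
Qed.
Fact tape_kernel1 : 1 \in tape_kernel.
Proof. by apply/tape_kernelP; exact: free_eval_one. Qed.
Fact tape_kernelV : invg_closed tape_kernel.
Proof.
by move=> x /tape_kernelP x1; apply/tape_kernelP; rewrite free_eval_inv x1 invg1.
Qed.
Fact tape_kernelJ x y : x \in tape_kernel -> x ^ y \in tape_kernel.
Proof.
move=> /tape_kernelP x1; apply/tape_kernelP.
by rewrite /conjg !free_eval_mul free_eval_inv x1 mul1g mulVg.
Qed.

HB.instance Definition _ := isMulClosed.Build F tape_kernel tape_kernelM.
HB.instance Definition _ := isMul1Closed.Build F tape_kernel tape_kernel1.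
HB.instance Definition _ := isInvClosed.Build F tape_kernel tape_kernelV.
HB.instance Definition _ := isConjClosed.Build F tape_kernel tape_kernelJ.

Lemma free_eval_val w : free_eval move (word_value X w) = run w.
Proof. by rewrite free_word_value free_eval_pi. Qed.

Lemma val_kernel w : (word_value X w \in tape_kernel) = (run w == 1).
Proof. by rewrite -free_eval_val. Qed.

(** * Normal form of the action and the word problem of F/N *)

Section Trace.
Local Open Scope ring_scope.

(* The displacement of the head along a word, the positions relative to the start
   of its writings and of its togglings, and the places [y - x] of the first tape
   for a toggling at [y] preceding a writing at [x]. *)
Definition trace_step (a : 'I_3 * bool) (r : int * (seq int * (seq int * seq int)))
    : int * (seq int * (seq int * seq int)) :=
  if a.1 == 0%N :> nat then (r.1, (0 :: r.2.1, (r.2.2.1, r.2.2.2))) else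
  if a.1 == 1%N :> nat then
    (r.1, (r.2.1, (0 :: r.2.2.1, r.2.2.2 ++ map (fun x => - x) r.2.1))) else
  if a.2 then (r.1 - 1, (map (fun x => x - 1) r.2.1,
                         (map (fun x => x - 1) r.2.2.1, r.2.2.2)))
  else (r.1 + 1, (map (fun x => x + 1) r.2.1,
                  (map (fun x => x + 1) r.2.2.1, r.2.2.2))).

Definition trace (w : word 3) := foldr trace_step (0, ([::], ([::], [::]))) w.
Definition shift w := (trace w).1.
Definition writes w := (trace w).2.1.
Definition toggles w := (trace w).2.2.1.
Definition marks w := (trace w).2.2.2.

Lemma odd_count_addb A (f g : pred A) s :
  odd (count (fun x => f x (+) g x) s) = odd (count f s) (+) odd (count g s).
Proof.
elim: s => //= x s IHs; rewrite !oddD IHs !oddb.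
by case: (f x) (g x) (odd _) (odd _) => [] [] [] [].
Qed.

(** A writing at relative position [x] copies [q (d + s + x)], altered by the earlier togglings at
    the [y] with [y - x = d]. The first contribution depends only on [writes], and the second,
    independent of the tapes, on [marks]. *)
Lemma run_state w (s : int) (p q : int -> bool) : run w (s, (p, q)) =
  (s + shift w,
   (fun d => p d (+) (~~ erased d &&
      (odd (count (fun x => q (d + s + x)) (writes w)) (+) odd (count_mem d (marks w)))),
    fun d => q d (+) odd (count_mem (d - s) (toggles w)))).
Proof.
elim: w s p q => [|[i b] w IHw] s p q.
  rewrite word_value_nil /shift /=; congr (_, (_, _)); first by lia.
    by apply: funext => d; rewrite andbF addbF.
  by apply: funext => d; rewrite addbF.
have -> : run ((i, b) :: w) (s, (p, q)) =
    run w ((if b then (move i)^-1%g else move i) (s, (p, q))).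
  by rewrite word_value_cons.
rewrite /shift /writes /toggles /marks /= -/(trace w) /trace_step /move.
case: i => [[|[|i]] lti] /=.
- have -> : (if b then (Bijection write_funK write_funK)^-1%g
      else Bijection write_funK write_funK) (s, (p, q)) = write_fun (s, (p, q)).
    by case: b.
  rewrite IHw /=; congr (_, (_, _)); apply: funext => d.
  rewrite GRing.addr0 -addbA oddD oddb; congr (_ (+) _).
  by rewrite -andb_addr addbA.
- have -> : (if b then (Bijection toggle_funK toggle_funK)^-1%g
      else Bijection toggle_funK toggle_funK) (s, (p, q)) = toggle_fun (s, (p, q)).
    by case: b.
  rewrite IHw /=; congr (_, (_, _)); apply: funext => d.
    rewrite odd_count_addb count_cat oddD count_map -addbA; congr (_ (+) (_ && _)).
    congr (_ (+) _); rewrite addbC; congr (_ (+) odd _).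
    by apply: eq_count => x /=; lia.
  rewrite -addbA oddD oddb; congr (_ (+) (_ (+) _)); lia.
case: b => /=; rewrite IHw /=; (congr (_, (_, _)); [by rewrite /shift; lia | |];
  apply: funext => d; rewrite count_map); [congr (_ (+) (_ && (odd _ (+) _)))
  | congr (_ (+) odd _) | congr (_ (+) (_ && (odd _ (+) _))) | congr (_ (+) odd _)];
  apply: eq_count => x /=; try congr q; lia.
Qed.

End Trace.

Lemma odd_count_even (A : eqType) (f : pred A) (s : seq A) :
  (forall x, ~~ odd (count_mem x s)) -> odd (count f s) = false.
Proof.
have [k] := ubnP (size s); elim: k s => // k IHk [|x s] //= ltk ev.
have xs : x \in s.
  by rewrite -has_pred1 has_count; have := ev x; rewrite eqxx; case: count.
have /permP sE := perm_to_rem xs; rewrite sE /= addnA addnn oddD odd_double /=.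
apply: IHk => [|y]; first by rewrite size_rem //; move: ltk; case: (size s) => //= m; lia.
by have := ev y; rewrite sE /= addnA addnn oddD odd_double.
Qed.

Definition even_mults (s : seq int) := all (fun x => ~~ odd (count_mem x s)) s.

Lemma even_multsP s : reflect (forall x, ~~ odd (count_mem x s)) (even_mults s).
Proof.
apply: (iffP allP) => [ev x|ev x _ //].
by have [/ev //|/count_memPn ->] := boolP (x \in s).
Qed.

Definition trivial_word (w : word 3) : bool :=
  [&& shift w == 0%R, even_mults (writes w), even_mults (toggles w) &
    all (fun d => erased d || ~~ odd (count_mem d (marks w))) (marks w)].

Lemma trivial_wordP w : trivial_word w = (word_value X w \in tape_kernel).
Proof.
rewrite val_kernel; apply/and4P/eqP => [[/eqP s0 /even_multsP w0 /even_multsP t0 /allP m0]|w1].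
  apply: bijection_eq => -[s [p q]]; rewrite run_state s0 /=.
  congr (_, (_, _)); first by lia.
    apply: funext => d; rewrite odd_count_even //=.
    have [|/count_memPn ->] := boolP (d \in marks w); last by rewrite andbF addbF.
    by move/m0; case: erased => /=; rewrite ?addbF // => /negbTE ->; rewrite addbF.
  by apply: funext => d; rewrite (negbTE (t0 _)) addbF.
have run1 s p q := run_state w s p q; rewrite w1 in run1.
have m0 d : ~~ erased d && odd (count_mem d (marks w)) = false.
  have [_ /(congr1 (fun f => f d)) /= + _] := run1 0%R (fun _ => false) (fun _ => false).
  by rewrite count_pred0.
split.
- by have [+ _ _] := run1 0%R (fun _ => false) (fun _ => false); rewrite GRing.add0r => <-.
(* The cell 0 is never erased. With a single 1 at [x] on the second tape, it displays the parity of
   the writings at [x]. *)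
- apply/even_multsP => x; have := m0 0%R; rewrite /= => m00.
  have [_ /(congr1 (fun f => f 0%R)) /= + _] := run1 0%R (fun _ => false) (fun y => y == x).
  rewrite m00 addbF !GRing.addr0; under eq_count do rewrite GRing.add0r.
  by move=> <-.
- apply/even_multsP => x.
  have [_ _ /(congr1 (fun f => f x)) /=] := run1 0%R (fun _ => false) (fun _ => false).
  by rewrite GRing.subr0 => <-.
- by apply/allP => d _; have := m0 d; case: erased => //= ->.
Qed.

Lemma comp_erased C {cC : context C} (G : C -> int) : computable G ->
  computable (fun g => erased (G g)).
Proof.
move=> PG; refine (comp_ext (F := fun g => let m := encode (G g) in
  ~~ odd m && ((0 < m) && T (code_head m./2) (code_tail m./2))) _ _) => [g|].
  case: (G g) => m; rewrite /encode /= ?odd_double //=.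
  by rewrite doubleK double_gt0.
rewrite /code_head /code_tail /=.
have PT C' (cC' : context C') (K L : C' -> nat) : computable K -> computable L ->
    computable (fun g => T (K g) (L g)).
  by move=> PK PL; apply: (comp_app2 comp_T PK PL).
comp; apply: PT; comp.
Qed.

Lemma comp_trace_step C {cC : context C} (L : C -> 'I_3 * bool)
    (R : C -> int * (seq int * (seq int * seq int))) :
  computable L -> computable R -> computable (fun g => trace_step (L g) (R g)).
Proof.
move=> PL PR; rewrite /trace_step.
have Pn C' (cC' : context C') (K : C' -> 'I_3) : computable K ->
  computable (fun g => nat_of_ord (K g)) by exact: comp_encode.
comp; apply: Pn; comp.
Qed.

Lemma comp_trace C {cC : context C} (G : C -> word 3) : computable G ->
  computable (fun g => trace (G g)).
Proof.
move=> PG; refine (comp_ext (F := fun g =>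
  foldr (fun a r => trace_step a r) (0%R, ([::], ([::], [::]))) (G g)) _ _) => //.
by comp; apply: comp_trace_step; comp.
Qed.

Lemma comp_count_mem C {cC : context C} (A : eqType) {eA : encoding A} (G : C -> A)
    (H : C -> seq A) : injective eA -> computable G -> computable H ->
  computable (fun g => count_mem (G g) (H g)).
Proof.
move=> inj PG PH.
refine (comp_ext (F := fun g => count (fun a => a == G g) (H g)) _ _) => //.
comp.
Qed.

Ltac step_tape := lazymatch goal with
  | |- computable (fun g => count_mem _ _) =>
      refine (comp_count_mem _ _ _); [solve [encode_inj] | ..]
  | |- computable (fun g => erased _) => refine (comp_erased _)
  | |- computable (fun g => trace _) => refine (comp_trace _)
  | |- _ => step_coding
  end.
Ltac comp_step ::= step_tape.

Lemma comp_trivial_word :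
  computable (fun p : word 3 * unit => trivial_word p.1).
Proof.
rewrite /trivial_word /shift /writes /toggles /marks /even_mults; comp.
Qed.

(** * Bounded exponents for membership in N<v> *)

Section PowerBound.
Local Open Scope ring_scope.

Lemma shift_size w : (`|shift w| <= size w)%N.
Proof.
elim: w => // -[i b] w; rewrite /shift /= -/(trace w) /trace_step /=.
by case: i => [[|[|i]] lti] /=; try case: b => /=; lia.
Qed.

Lemma run_shift w s : (run w s).1 = s.1 + shift w.
Proof. by case: s => s [p q]; rewrite run_state. Qed.

Lemma run_expn_shift v k s : ((run v ^+ k)%g s).1 = s.1 + shift v *+ k.
Proof.
elim: k s => [|k IHk] s; first by rewrite GRing.addr0.
have -> : (run v ^+ k.+1)%g s = (run v ^+ k)%g (run v s) by rewrite expgS.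
by rewrite IHk run_shift GRing.mulrS GRing.addrA.
Qed.

(** The square of a word without shift restores the second tape and adds to the first a pattern
    independent of both tapes; done twice, this cancels. *)
Lemma run_exp4 v : shift v = 0 -> (run v ^+ 4 = 1)%g.
Proof.
move=> v0; pose m (s d : int) := ~~ erased d &&
  odd (count (fun x => odd (count_mem (d + s + x - s) (toggles v))) (writes v)).
have run2 s p q : run v (run v (s, (p, q))) = (s, (fun d => p d (+) m s d, q)).
  rewrite !run_state v0 !GRing.addr0; congr (_, (_, _)); apply: funext => d.
    rewrite odd_count_addb -addbA /m; congr (_ (+) _).
    by case: erased => //=; case: (odd _) (odd (count_mem _ _)) (odd _) => [] [] [].
  by rewrite -addbA addbb addbF.
apply: bijection_eq => -[s [p q]].
rewrite -[LHS]/(run v (run v (run v (run v (s, (p, q)))))) !run2 /=.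
congr (_, (_, _)); apply: funext => d.
by rewrite -addbA addbb addbF.
Qed.

End PowerBound.

(** If [v] moves the head, the head positions give [k |shift v| = |shift w|], which is at most
    [size w], so [k] is already small. Otherwise [k] is reduced modulo 4. The bound [size w + 5]
    covers both cases. *)
Lemma power_bound_aux v w k : run w * run v ^+ k = 1 -> exists k',
  (k' < size w + 5)%N /\ run w * run v ^+ k' = 1.
Proof.
move=> wk; have [v0|v0] := eqVneq (shift v) 0%R.
  exists (k %% 4)%N; split; first by have := ltn_pmod k (isT : (0 < 4)%N); lia.
  by move: wk; rewrite {1}(divn_eq k 4) expgnDr mulnC expgnA run_exp4 // expg1n mul1g.
exists k; split=> //.
have := congr1 (fun f : bijection state => (f (0%R, (fun _ => false, fun _ => false))).1) wk.
rewrite -[bij_fun (_ * _) _]/((run v ^+ k) (run w _)) run_expn_shift run_shift /=.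
have := shift_size w; nia.
Qed.

Lemma tape_power_bound v w :
  by_cyclic (fun x => x \in tape_kernel) (word_value X v) (word_value X w) ->
  exists k, (k < size w + 5)%N /\
    (word_value X w * word_value X v ^+ k \in tape_kernel \/
     word_value X w * word_value X v ^- k \in tape_kernel).
Proof.
have valX u k : word_value X u ^+ k = word_value X (word_exp u k).
  by rewrite word_value_exp.
move=> [i [j]]; rewrite !valX -word_value_inv -!word_value_cat val_kernel => /eqP.
rewrite !word_value_cat word_value_inv !word_value_exp => wij.
have [ji|ij] := leqP j i.
  have [|k [ltk kE]] := @power_bound_aux v w (i - j).
    by rewrite expgnFr // mulgA.
  exists k; split=> //; left.
  by rewrite valX -word_value_cat val_kernel word_value_cat word_value_exp kE.
have [|k [ltk kE]] := @power_bound_aux (word_inv v) w (j - i).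
  rewrite word_value_inv expVgn expgnFr 1?ltnW // invgM invgK mulgA.
  exact: wij.
exists k; split=> //; right.
rewrite valX -word_value_inv -word_value_cat val_kernel word_value_cat.
by rewrite word_value_inv word_value_exp -expVgn -word_value_inv kE.
Qed.

(** * Words whose conjugacy encodes the projection of T *)

Definition letter (i : nat) (b : bool) : 'I_3 * bool := (inord i, b).

Definition go k : word 3 := nseq k (letter 2 false).
Definition back k : word 3 := nseq k (letter 2 true).
Definition flip_at k : word 3 := go k ++ letter 1 false :: back k.
Definition write : word 3 := [:: letter 0 false].

(* [base_word e] adds to the first tape the second one and its translate by
   [2 ^ e.+1], and [marked_word e] also flips the cell [2 ^ e] of the first tape. *)
Definition base_word e : word 3 :=
  write ++ go (2 ^ e.+1)%N ++ write ++ back (2 ^ e.+1)%N.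
Definition marked_word e : word 3 :=
  base_word e ++ flip_at (2 ^ e)%N ++ write ++ flip_at (2 ^ e)%N ++ write.

Section Runs.
Local Open Scope ring_scope.

Lemma run_go k s : run (go k) s = (s.1 + k%:Z, s.2).
Proof.
elim: k s => [|k IHk] s; first by rewrite word_value_nil GRing.addr0; case: s.
have -> : run (go k.+1) s = run (go k) (right_fun s).
  by rewrite word_value_cons /= /move inordK.
by rewrite IHk /right_fun /=; congr (_, _); lia.
Qed.

Lemma run_back k s : run (back k) s = (s.1 - k%:Z, s.2).
Proof.
elim: k s => [|k IHk] s; first by rewrite word_value_nil GRing.subr0; case: s.
have -> : run (back k.+1) s = run (back k) (left_fun s).
  by rewrite word_value_cons /= /move inordK.
by rewrite IHk /left_fun /=; congr (_, _); lia.
Qed.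

Lemma run_write s : run write s = write_fun s.
Proof. by rewrite word_value_cons word_value_nil mulg1 /= /move inordK. Qed.

Lemma run_cat u w s : run (u ++ w) s = run w (run u s).
Proof. by rewrite word_value_cat. Qed.

Lemma run_flip_at k s p q : run (flip_at k) (s, (p, q)) =
  (s, (p, fun d => q d (+) (d == s + k%:Z))).
Proof.
rewrite run_cat run_go -cat1s run_cat run_back /=.
have -> : run [:: letter 1 false] = Bijection toggle_funK toggle_funK.
  by rewrite word_value_cons word_value_nil mulg1 /= /move inordK.
by rewrite /toggle_fun /=; congr (_, _); lia.
Qed.

Lemma run_base_word e s p q : run (base_word e) (s, (p, q)) =
  (s, (fun d => p d (+) (~~ erased d && (q (d + s) (+) q (d + s + (2 ^ e.+1)%N%:Z))), q)).
Proof.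
rewrite /base_word !run_cat run_write run_go run_write run_back /write_fun /=.
congr (_, (_, _)); first by lia.
apply: funext => d; rewrite -addbA -andb_addr; congr (_ (+) (_ && (_ (+) q _))); lia.
Qed.

(** The last four factors of [marked_word] form a commutator of two involutions: the two writings
    differ only by the toggled cell, whose distance from the head is [2 ^ e] wherever the head
    is. *)
Lemma run_marked_word e s p q : run (marked_word e) (s, (p, q)) =
  (s, (fun d => p d (+) (~~ erased d &&
    (q (d + s) (+) q (d + s + (2 ^ e.+1)%N%:Z) (+) (d == (2 ^ e)%N%:Z))), q)).
Proof.
rewrite /marked_word run_cat run_base_word run_cat run_flip_at.
rewrite run_cat run_write /write_fun /= run_cat run_flip_at run_write /write_fun /=.
congr (_, (_, _)); apply: funext => d; last by rewrite -addbA addbb addbF.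
rewrite -!addbA -!andb_addr; congr (_ (+) (_ && _)).
have -> : (d + s == s + (2 ^ e)%N%:Z) = (d == (2 ^ e)%N%:Z) by lia.
by case: (q _) (q _) (_ == _) => [] [] [].
Qed.

End Runs.

Lemma tape_conjugateP u v :
  conjugate (word_value (fun i => quotient_map tape_kernel (X i)) u)
            (word_value (fun i => quotient_map tape_kernel (X i)) v) <->
  exists h, run (h ++ v) = run (u ++ h).
Proof.
have evalM x y : free_eval move (x * y) = free_eval move x * free_eval move y.
  exact: free_eval_mul.
have evalV x : free_eval move x^-1 = (free_eval move x)^-1 by exact: free_eval_inv.
rewrite !word_value_quotient; split=> [[g]|[h hE]].
  have [x ->] := quotient_map_surj g; have [h ->] := free_group_gen x.
  rewrite /conjg -quotient_mapV -!quotient_mapM => /quotient_mapP/tape_kernelP.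
  rewrite !(evalM, evalV) !free_eval_val => E; exists h.
  by rewrite !word_value_cat -[LHS]mulg1 -E !mulgA mulgK mulgV mul1g.
exists (quotient_map tape_kernel (word_value X h)).
rewrite /conjg -quotient_mapV -!quotient_mapM; apply/quotient_mapP/tape_kernelP.
rewrite !(evalM, evalV) !free_eval_val.
by move: hE; rewrite !word_value_cat => <-; rewrite mulKg mulVg.
Qed.

Section Conjugacy.
Local Open Scope ring_scope.

Definition flips (ks : seq nat) : word 3 := flatten (map flip_at ks).

Lemma run_flips ks s p q : run (flips ks) (s, (p, q)) =
  (s, (p, fun d => q d (+) odd (count (fun k : nat => d == s + k%:Z) ks))).
Proof.
elim: ks q => [|k ks IHks] q.
  by rewrite word_value_nil /=; congr (_, (_, _)); apply: funext => d; rewrite addbF.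
rewrite /flips /= run_cat run_flip_at IHks; congr (_, (_, _)); apply: funext => d.
by rewrite /= oddD oddb addbA.
Qed.

Lemma conjugate_words e c : T e c ->
  exists h, run (h ++ marked_word e) = run (base_word e ++ h).
Proof.
move=> Tec; pose m := (2 ^ e.+1)%N; pose j := (2 ^ e)%N.
(* With [Y] the set of the [j + i m] for [i] from 1 to [c], the sum [Y(d) + Y(d + m)] telescopes to
   the two cells [j] and [j + c m]. The second is [2^e (2 c + 1)], which [T e c] erases. *)
exists (flips [seq (j + i * m)%N | i <- iota 1 c]).
apply: bijection_eq => -[s [p q]].
rewrite run_cat run_flips run_marked_word run_cat run_base_word run_flips.
congr (_, (_, _)); apply: funext => d; congr (_ (+) _).
have [//|nd] := boolP (erased d); rewrite /= -/m -/j.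
set f := fun k : nat => d + s == s + k%:Z; set f' := fun k : nat => d + s + m%:Z == s + k%:Z.
have -> : count f' [seq (j + i * m)%N | i <- iota 1 c] =
    count f [seq (j + i * m)%N | i <- iota 0 c].
  rewrite (iotaDl 1 0) -map_comp !count_map.
  by apply: eq_count => i /=; rewrite /f /f'; lia.
have E : (count f [seq (j + i * m)%N | i <- iota 1 c] + (d == j%:Z) =
    count f [seq (j + i * m)%N | i <- iota 0 c])%N.
  have nj : (f (j + c * m)%N) = false.
    apply/negP => /eqP dE; move: nd; suff -> : d = Posz (2 ^ e * c.*2.+1)%N by rewrite erased_code Tec.
    by move: dE; rewrite /j /m expnS; nia.
  have -> : (d == j%:Z) = f (j + 0 * m)%N by rewrite /f; lia.
  have E1 : count f [seq (j + i * m)%N | i <- iota 0 c.+1] =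
      (f (j + 0 * m)%N + count f [seq (j + i * m)%N | i <- iota 1 c])%N by [].
  rewrite -[c.+1]addn1 iotaD map_cat count_cat /= add0n nj in E1; lia.
move/(congr1 odd): E; rewrite oddD oddb => <-.
by case: (q _) (q _) (odd _) (_ == _) => [] [] [] [].
Qed.

Lemma int_seq_bound (s : seq int) : exists B : nat, forall d, d \in s -> (`|d| <= B)%N.
Proof.
elim: s => [|x s [B HB]]; first by exists 0%N.
exists (maxn `|x| B) => d; rewrite inE => /orP[/eqP ->|/HB]; rewrite leq_max ?leqnn //.
by move=> ->; rewrite orbT.
Qed.

(** If the progression [j + i m] meets no erased cell, the second tape left by [h] on blank tapes
    would, along it, change value exactly once, between [i = 0] and [i = 1]. A tape with finitely
    many ones vanishes far out on both sides, so this is impossible. *)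
Lemma words_not_conjugate e h : run (h ++ marked_word e) = run (base_word e ++ h) ->
  exists c, T e c.
Proof.
move=> hE; apply: contrapT => nT; pose m := (2 ^ e.+1)%N; pose j := (2 ^ e)%N.
have m0 : (0 < m)%N by rewrite expn_gt0.
pose s0 : state := (0, (fun _ => false, fun _ => false)).
have [r [p [Y [hs0 [B YB]]]]] : exists r p Y, run h s0 = (r, (p, Y)) /\
    exists B : nat, forall d, (B < `|d|)%N -> Y d = false.
  rewrite run_state; do 3!eexists; split; first by [].
  have [B HB] := int_seq_bound (toggles h); exists B => d ltd.
  rewrite GRing.subr0; suff /count_memPn -> : d \notin toggles h by [].
  by apply/negP => /HB; lia.
(* The base word leaves blank tapes blank, so the marked word must fix the state that [h] reaches
   from them. *)
have fixed : run (marked_word e) (r, (p, Y)) = (r, (p, Y)).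
  rewrite -hs0 -run_cat hE run_cat run_base_word /=; congr (run h (_, (_, _))).
  by apply: funext => d; rewrite andbF.
pose W (i : int) := Y (j%:Z + i * m%:Z + r).
have Wstep (i : int) : W i (+) W (i + 1) = (i == 0).
  move: fixed; rewrite run_marked_word -/m -/j => -[/(congr1 (fun f => f (j%:Z + i * m%:Z)))] /=.
  (* For [i >= 0] the cell is [2^e (2 i + 1)], and [T e i] fails by assumption; for [i < 0] it is
     negative, and negative cells are never erased. *)
  have -> : erased (j%:Z + i * m%:Z) = false.
    apply/negbTE/negP; case: i => i eri.
      case: nT; exists i; rewrite -erased_code; congr erased: eri.
      by rewrite /j /m expnS; lia.
    move: eri; case E: (j%:Z + _) => [k|k] // _.
    have j0 : (0 < j)%N by rewrite expn_gt0.
    by move: E; rewrite /m expnS -/j; nia.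
  have -> : W i = Y (j%:Z + i * m%:Z + r) by [].
  have -> : W (i + 1) = Y (j%:Z + i * m%:Z + r + m%:Z) by rewrite /W; congr Y; lia.
  have -> : (j%:Z + i * m%:Z == j%:Z) = (i == 0) by have := m0; nia.
  by case: (p _) (Y _) (Y _) (_ == _) => [] [] [] [].
have Wpos (k : nat) : W (1 + k%:Z) = W 1.
  elim: k => [|k <-]; first by rewrite GRing.addr0.
  have := Wstep (1 + k%:Z); have -> : (1 + k%:Z == 0) = false by lia.
  have -> : 1 + k%:Z + 1 = 1 + k.+1%:Z by lia.
  by case: (W _) (W _) => [] [].
have Wneg (k : nat) : W (- k%:Z) = W 0.
  elim: k => [|k <-]; first by rewrite GRing.oppr0.
  have := Wstep (- k.+1%:Z); have -> : (- k.+1%:Z == 0) = false by lia.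
  have -> : - k.+1%:Z + 1 = - k%:Z by lia.
  by case: (W _) (W _) => [] [].
(* Large enough that, [m] being positive, going [k] steps of length [m] either way leaves the
   support of [Y], despite the offsets [j] and [r]. *)
pose k := (B + `|r| + j).+1.
have km : (k <= k * m)%N by apply: leq_pmulr.
have W1 : W 1 = false.
  by rewrite -(Wpos k) /W; apply: YB; rewrite /k in km *; lia.
have W0 : W 0 = false.
  by rewrite -(Wneg k) /W; apply: YB; rewrite /k in km *; lia.
by have := Wstep 0; rewrite GRing.add0r W0 W1.
Qed.

End Conjugacy.

Lemma conjugate_wordsP e :
  (exists h, run (h ++ marked_word e) = run (base_word e ++ h)) <-> exists c, T e c.
Proof. by split=> [[h]|[c]]; [exact: words_not_conjugate | exact: conjugate_words]. Qed.

Section ComputableWords.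
Context {C : Type} {cC : context C}.

Lemma comp_nseq A {eA : encoding A} (a : A) (K : C -> nat) : computable K ->
  computable (fun g => nseq (K g) a).
Proof.
move=> PK; refine (comp_ext (F := fun g => iter (K g) (fun s => a :: s) [::]) _ _).
  by move=> g; elim: (K g) => //= k ->.
comp.
Qed.

Lemma comp_flip_at (K : C -> nat) : computable K ->
  computable (fun g => flip_at (K g)).
Proof. by move=> PK; rewrite /flip_at; comp; apply: comp_nseq. Qed.

Lemma comp_base_word (K : C -> nat) : computable K ->
  computable (fun g => base_word (K g)).
Proof. by move=> PK; rewrite /base_word; comp; apply: comp_nseq; comp. Qed.

Lemma comp_marked_word (K : C -> nat) : computable K ->
  computable (fun g => marked_word (K g)).
Proof.
move=> PK; rewrite /marked_word; comp; first exact: comp_base_word.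
  by apply: comp_flip_at; comp.
by apply: comp_flip_at; comp.
Qed.

End ComputableWords.

Lemma tape_conjugacy_undecidable :
  ~ computable (fun p : nat * unit => `[< exists c, T p.1 c >]) ->
  ~ conjugacy_problem_decidable (fun i => quotient_map tape_kernel (X i)).
Proof.
move=> undec dec; apply: undec.
have Pb : computable (fun p : nat * unit => base_word p.1) by apply: comp_base_word; comp.
have Pm : computable (fun p : nat * unit => marked_word p.1) by apply: comp_marked_word; comp.
apply: comp_ext (recursive_words2_comp dec Pb Pm) => p.
apply: asbool_equiv_eq; split; first by move/tape_conjugateP/conjugate_wordsP.
by move/conjugate_wordsP/tape_conjugateP.
Qed.

End TapeGroup.

Theorem theorem6p17 :
  exists (n : nat) (F : groupType) (X : 'I_n -> F) (N : normalSubgroup F),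
    [/\ free_basis X,
        recursive_words (fun w : word n => word_value X w \in N),
        ~ conjugacy_problem_decidable
            (fun i => quotient_map N (X i))
      & conjugacy_problem_decidable
            (fun i => quotient_map (derived N : normalSubgroup F) (X i))].
Proof.
have [T [comp_T undec_T]] := undecidable_projection.
exists 3, (free_group 3), (@free_gen 3),
  (tape_kernel T : normalSubgroup (free_group 3)); split.
- exact: free_group_basis.
- apply: recursive_wordsP; apply: comp_ext (comp_trivial_word comp_T) => -[w []] /=.
  by rewrite asboolb trivial_wordP.
- exact: (tape_conjugacy_undecidable undec_T).
- exact: (conjugacy_problem_derived_decidable (@free_group_basis 3)
    (@free_group_gen 3) (@trivial_wordP T) (comp_trivial_word comp_T)
    (@tape_power_bound T)).
Qed.
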